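(* Let $k$ be a fixed positive integer (not depending on $n$). For the binomial random intersection graph $G_b(n,P_n,p_n)$, define $\alpha_n$ by $$p_n^2P_n=\frac{\ln n+(k-1)\ln\ln n+\alpha_n}{n}.$$ If $P_n=\Omega\big(n(\ln n)^5\big)$ and $|\alpha_n|=o(\ln n)$, then $$\lim_{n\to\infty}\mathbb{P}[G_b(n,P_n,p_n)\text{ is }k\text{-robust}]=\begin{cases}0,&\text{if }\lim_{n\to\infty}\alpha_n=-\infty,\\ 1,&\text{if }\lim_{n\to\infty}\alpha_n=\infty.\end{cases}$$
   Context: Binomial random intersection graph $G_b(n,P_n,p_n)$: $n$ nodes $v_1,\ldots,v_n$ and a pool of $P_n$ distinct objects; each node $v_i$ gets an object set $S_i$ obtained by including each object independently with probability $p_n$, independently over nodes; distinct $v_i,v_j$ are adjacent iff $S_i\cap S_j\neq\emptyset$. A graph with node set $\mathcal{V}$ is $k$-robust if for every nonempty proper subset $T\subsetneq\mathcal{V}$, either some node in $T$ has at least $k$ neighbors in $\mathcal{V}\setminus T$, or some node in $\mathcal{V}\setminus T$ has at least $k$ neighbors in $T$. All limits and asymptotic notation are as $n\to\infty$. *)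

(* Defs.v *)
From mathcomp Require Import all_boot all_order all_algebra.
From mathcomp Require Import all_classical all_reals all_analysis.
Set Implicit Arguments.
Unset Strict Implicit.
Unset Printing Implicit Defensive.
Import Order.TTheory GRing.Theory Num.Theory.
Import numFieldNormedType.Exports.
Local Open Scope ring_scope.

Definition k_robust (V : finType) (adj : rel V) (k : nat) : bool :=
  [forall T : {set V}, (T != finset.set0) && (T != finset.setT) ==>
     [exists x in T, (k <= #|[set y in ~: T | adj x y]|)%N] ||
     [exists x in ~: T, (k <= #|[set y in T | adj x y]|)%N]]%SET.

(* [S i] is the object set of node [i]. *)
Definition intersection_adj (n P : nat)
    (S : {ffun 'I_n -> {set 'I_P}}) : rel 'I_n :=
  fun i j => (i != j) && (S i :&: S j != finset.set0)%SET.

(* The joint law of the object sets: the n * P inclusion events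
   "object o is in S i" are independent, each of probability p. *)
Definition object_sets_pmf (R : realType) (n P : nat) (p : R)
    (S : {ffun 'I_n -> {set 'I_P}}) : R :=
  \prod_(i < n) \prod_(o < P) (if o \in S i then p else 1 - p).

Definition Gb_prob (R : realType) (n P : nat) (p : R) (E : rel 'I_n -> bool) : R :=
  \sum_(S : {ffun 'I_n -> {set 'I_P}} | E (intersection_adj S))
     object_sets_pmf p S.

Lemma object_sets_pmf_ge0 (R : realType) (n P : nat) (p : R)
    (S : {ffun 'I_n -> {set 'I_P}}) : 0 <= p <= 1 -> 0 <= object_sets_pmf p S.
Proof.
move=> /andP[p0 p1]; apply: prodr_ge0 => i _; apply: prodr_ge0 => o _.
by case: ifP => // _; rewrite subr_ge0.
Qed.

Lemma Gb_prob_total (R : realType) (n P : nat) (p : R) :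
  Gb_prob P p (fun _ : rel 'I_n => true) = 1.
Proof.
rewrite /Gb_prob /object_sets_pmf.
rewrite -(bigA_distr_bigA (fun (_ : 'I_n) (A : {set 'I_P}) =>
  \prod_(o < P) (if o \in A then p else 1 - p))).
rewrite big1// => _ _.
have := @bigA_distr R 0 1 *%R +%R _ (fun _ : 'I_P => p) (fun _ => 1 - p).
rewrite big1 => [|o _]; last exact: (subrKC p 1).
by move=> e; rewrite [RHS]e; apply: eq_bigl.
Qed.

(* Main.v *)
Require Import Defs.
From mathcomp Require Import all_boot all_order all_algebra.
From mathcomp Require Import all_classical all_reals all_analysis.
From mathcomp Require Import ring lra zify.
Set Implicit Arguments.
Unset Strict Implicit.
Unset Printing Implicit Defensive.
Import Order.TTheory GRing.Theory Num.Theory.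
Import numFieldNormedType.Exports.
Local Open Scope ring_scope.

(** Dually to the object sets, every object [o] has a set [holders S o] of nodes,
    and these holder sets are i.i.d. over the objects, each node belonging to a
    given one with probability [p].  Since [n p ln n] tends to 0, objects with
    three or more holders are negligible, and an object with holders [{i, j}]
    just adds the edge [ij]; its probability is [beta = p^2 (1 - p)^(n - 2)].

    If [alpha] tends to +oo: for [|T| = t <= n / 2], let [Z] be the number of pairs
    in [T * ~: T] that are the holder set of some object.  If every node of [T] has
    at most [l = k - 1] neighbours outside [T] then [Z <= l t], so by Markov with
    [x = 1 / ln n] this has probability at most [x^(- l t) E[x^Z]].  The pairs
    compete for the objects, so [x^Z] has at most the mean it would have for
    independent pairs, namely [(x + (1 - x) (1 - beta)^P)^(t (n - t))].
    The union bound over [T] is then at most [2 exp (5 - alpha)].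

    If [alpha] tends to -oo: count the nodes [i] belonging to exactly [l] holder
    sets of size 2 and to none of size at least 3.  They have degree at most [l],
    which contradicts [k]-robustness on [T = {i}].  Their expected number is at
    least a constant times [exp (- alpha)], and by the second moment method there
    is such a node with probability tending to 1. *)

(** * Events on holder sets *)

Definition holders {n P : nat} (S : {ffun 'I_n -> {set 'I_P}}) (o : 'I_P) : {set 'I_n} :=
  [set i | o \in S i].

(** Unlike in [Gb_prob], the event may depend on the object sets themselves and not only on the
    resulting graph, as statements about holder sets require. *)
Definition Gb_event_prob {R : realType} {n P : nat} (p : R)
    (E : pred {ffun 'I_n -> {set 'I_P}}) : R :=
  \sum_(S | E S) object_sets_pmf p S.

Definition holder_pmf {R : realType} {n : nat} (p : R) (H : {set 'I_n}) : R :=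
  \prod_(i < n) (if i \in H then p else 1 - p).

Definition holder_prob {R : realType} {n : nat} (p : R) (q : pred {set 'I_n}) : R :=
  \sum_(H | q H) holder_pmf p H.

Lemma prod_if_mem (R : realType) (T : finType) (A : {set T}) (u v : R) :
  \prod_(o : T) (if o \in A then u else v) = u ^+ #|A| * v ^+ (#|T| - #|A|).
Proof.
rewrite (bigID (mem A))/=; congr (_ * _).
  by rewrite (eq_bigr (fun=> u)) ?prodr_const // => i ->.
rewrite (eq_bigr (fun=> v)) => [|i /negbTE->//].
rewrite prodr_const; congr (_ ^+ _).
have <- : #|~: A| = (#|T| - #|A|)%N by have := cardsC A; lia.
by apply: eq_card => i; rewrite !inE.
Qed.

(** * The law of the holder sets *)

Section HolderLaw.
Variables (R : realType) (n P : nat) (p : R).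
Hypothesis p01 : 0 <= p <= 1.
Implicit Types (H : {set 'I_n}) (S : {ffun 'I_n -> {set 'I_P}}).

Let p0 : 0 <= p. Proof. by case/andP: p01. Qed.
Let p1 : 0 <= 1 - p. Proof. by rewrite subr_ge0; case/andP: p01. Qed.

Lemma holder_pmf_ge0 H : 0 <= holder_pmf p H.
Proof. by apply: prodr_ge0 => i _; case: ifP. Qed.

Lemma holder_pmfE H : holder_pmf p H = p ^+ #|H| * (1 - p) ^+ (n - #|H|).
Proof. by rewrite /holder_pmf prod_if_mem card_ord. Qed.

(** Giving weight 0 to the absence of a node of [I] leaves exactly the sets containing [I]; the sum
    over all sets then factors over the nodes, and a node outside [I] contributes
    [p + (1 - p) = 1]. *)
Lemma holder_prob_subset (I : {set 'I_n}) :
  holder_prob p (fun H => I \subset H) = p ^+ #|I|.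
Proof.
transitivity (\sum_(H : {set 'I_n}) \prod_(i < n)
    (if i \in H then p else (if i \in I then 0 else 1 - p))).
  rewrite [RHS](bigID (fun H => I \subset H))/= [X in _ = _ + X]big1 ?addr0.
    apply: eq_bigr => H /fintype.subsetP IH; apply: eq_bigr => i _.
    by case: ifPn => // iH; case: ifPn => // /IH; rewrite (negbTE iH).
  move=> H /fintype.subsetPn[i iI iH]; rewrite (bigD1 i)//= (negbTE iH) iI.
  by rewrite mul0r.
have /= <- := @bigA_distr R 0 1 *%R +%R _ (fun _ : 'I_n => p)
   (fun i => if i \in I then 0 else 1 - p).
rewrite (bigID (mem I))/= [X in _ * X]big1 ?mulr1.
  by rewrite (eq_bigr (fun=> p)) ?prodr_const // => i ->; rewrite addr0.
by move=> i /negbTE->; rewrite subrKC.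
Qed.

Lemma holder_prob_true : holder_prob p (fun _ : {set 'I_n} => true) = 1.
Proof.
rewrite -[RHS](expr0 p) -(cards0 'I_n) -holder_prob_subset.
by apply: eq_bigl => H; rewrite finset.sub0set.
Qed.

Lemma holder_prob_ge0 (q : pred {set 'I_n}) : 0 <= holder_prob p q.
Proof. by apply: sumr_ge0 => H _; exact: holder_pmf_ge0. Qed.

Lemma le_holder_prob (q q' : pred {set 'I_n}) :
  (forall H, q H -> q' H) -> holder_prob p q <= holder_prob p q'.
Proof.
move=> qq'; rewrite /holder_prob big_mkcond [leRHS]big_mkcond/=.
apply: ler_sum => H _; case: ifPn => [/qq'->//|_].
by case: ifP => // _; exact: holder_pmf_ge0.
Qed.

Lemma holder_probC (q : pred {set 'I_n}) :
  holder_prob p (fun H => ~~ q H) = 1 - holder_prob p q.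
Proof. by rewrite -holder_prob_true /holder_prob [in RHS](bigID q)/= addrAC subrr add0r. Qed.

Lemma holder_prob_le1 (q : pred {set 'I_n}) : holder_prob p q <= 1.
Proof. by rewrite -subr_ge0 -holder_probC holder_prob_ge0. Qed.

(** Independence of the holder sets: transposing the incidence relation turns families of object
    sets into families of holder sets, and the sum over the latter factors over the objects. *)
Lemma Gb_event_prob_forall (q : 'I_P -> pred {set 'I_n}) :
  Gb_event_prob p (fun S => [forall o, q o (holders S o)]) =
  \prod_(o < P) holder_prob p (q o).
Proof.
pose h (f : {ffun 'I_P -> {set 'I_n}}) : {ffun 'I_n -> {set 'I_P}} :=
  [ffun i => [set o | i \in f o]].
pose g (S : {ffun 'I_n -> {set 'I_P}}) : {ffun 'I_P -> {set 'I_n}} :=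
  [ffun o => [set i | o \in S i]].
have hK : cancel h g.
  by move=> f; apply/ffunP => o; apply/setP => i; rewrite !(ffunE, inE).
have gK : cancel g h.
  by move=> f; apply/ffunP => o; apply/setP => i; rewrite !(ffunE, inE).
rewrite /Gb_event_prob (reindex h)/=; last by exists g => f _; rewrite ?hK ?gK.
transitivity (\sum_(f : {ffun 'I_P -> {set 'I_n}})
   \prod_(o < P) (if q o (f o) then holder_pmf p (f o) else 0)).
  rewrite big_mkcond/=; apply: eq_bigr => f _.
  have hf o : holders (h f) o = f o by apply/setP => i; rewrite !(inE, ffunE).
  case: ifPn => [/forallP qf|]; last first.
    rewrite negb_forall => /existsP[ o]; rewrite hf => /negbTE qo.
    by rewrite (bigD1 o)//= qo mul0r.
  rewrite /object_sets_pmf exchange_big/=; apply: eq_bigr => o _.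
  move: (qf o); rewrite hf => ->; apply: eq_bigr => i _.
  by rewrite ffunE inE.
rewrite -(bigA_distr_bigA (fun o H => if q o H then holder_pmf p H else 0)).
by apply: eq_bigr => o _; rewrite -big_mkcond.
Qed.

Lemma Gb_event_prob_ge0 (E : pred {ffun 'I_n -> {set 'I_P}}) : 0 <= Gb_event_prob p E.
Proof. by apply: sumr_ge0 => S _; exact: object_sets_pmf_ge0. Qed.

Lemma le_Gb_event_prob (E E' : pred {ffun 'I_n -> {set 'I_P}}) :
  (forall S, E S -> E' S) -> Gb_event_prob p E <= Gb_event_prob p E'.
Proof.
move=> EE'; rewrite /Gb_event_prob big_mkcond [leRHS]big_mkcond/=.
apply: ler_sum => S _; case: ifPn => [/EE'->//|_].
by case: ifP => // _; exact: object_sets_pmf_ge0.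
Qed.

Lemma holder_pmf_pair (i j : 'I_n) : i != j ->
  holder_pmf p [set i; j] = p ^+ 2 * (1 - p) ^+ (n - 2).
Proof. by move=> ij; rewrite holder_pmfE cards2 ij. Qed.

End HolderLaw.

Lemma Bernoulli_ineq {R : realFieldType} (y : R) (m : nat) :
  0 <= y <= 1 -> 1 - m%:R * y <= (1 - y) ^+ m.
Proof.
move=> /andP[y0 y1]; elim: m => [|m IH]; first by rewrite mul0r subr0.
rewrite exprS; apply: le_trans (ler_wpM2l _ IH); last by rewrite subr_ge0.
have : 0 <= m%:R * y ^+ 2 by rewrite mulr_ge0// sqr_ge0.
rewrite -natr1; nra.
Qed.

(** * Sparse cuts *)

Section SparseCut.
Variables (R : realType) (n P : nat) (p x : R).
Hypothesis p01 : 0 <= p <= 1.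
Hypothesis x01 : 0 < x <= 1.
Implicit Types (S : {ffun 'I_n -> {set 'I_P}}).

Let x0 : 0 < x. Proof. by case/andP: x01. Qed.
Let x1 : 0 <= 1 - x. Proof. by rewrite subr_ge0; case/andP: x01. Qed.

Definition pair_unused S (e : 'I_n * 'I_n) :=
  [forall o, holders S o != [set e.1; e.2]].

Lemma pair_unused_adj S (i j : 'I_n) : i != j ->
  ~~ intersection_adj S i j -> pair_unused S (i, j).
Proof.
move=> ij; rewrite /intersection_adj ij/= negbK => /eqP Sij.
apply/forallP => o; apply/eqP => Ho.
have: o \in S i :&: S j.
  have /setP Hi := Ho; rewrite inE.
  by have := Hi i; have := Hi j; rewrite !inE !eqxx orbT => -> ->.
by rewrite Sij inE.
Qed.

Let beta := p ^+ 2 * (1 - p) ^+ (n - 2).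

(* No holder set lies in [J] with probability [(1 - |J| beta)^P]; Bernoulli's
   inequality compares this with [|J|] independent pairs. *)
Lemma Gb_event_prob_pairs_unused (T : {set 'I_n}) (J : {set 'I_n * 'I_n}) :
  J \subset finset.setX T (~: T) ->
  Gb_event_prob (P := P) p (fun S => [forall e in J, pair_unused S e]) <=
  (1 - beta) ^+ P ^+ #|J|.
Proof.
move=> /fintype.subsetP JT; pose f (e : 'I_n * 'I_n) := [set e.1; e.2].
(* [T] and its complement are disjoint, so the unordered pair determines the ordered one. *)
have finj : {in J &, injective f}.
  move=> [i j] [i' j'] /JT; rewrite !inE/= => /andP[iT jT] /JT; rewrite !inE/= => /andP[iT' jT'].
  rewrite /f/= => /setP eqf.
  have := eqf i; rewrite !inE eqxx/= => /esym/orP[/eqP ii'|/eqP ij']; last first.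
    by move: jT'; rewrite -ij' iT.
  have := eqf j; rewrite !inE eqxx orbT/= => /esym/orP[/eqP ji'|/eqP jj'].
    by move: jT; rewrite ji' iT'.
  by rewrite ii' jj'.
have betaE : holder_prob p (fun H => H \in f @: J) = #|J|%:R * beta.
  rewrite /holder_prob (eq_bigr (fun=> beta)).
    by rewrite sumr_const card_in_imset// mulr_natl.
  move=> H /imsetP[[i j] /JT]; rewrite !inE/= => /andP[iT jT] ->.
  by rewrite /f holder_pmf_pair//=; apply: contraNneq jT => <-.
rewrite [leLHS](_ : _ = (1 - #|J|%:R * beta) ^+ P); last first.
  transitivity (Gb_event_prob (P := P) p
      (fun S => [forall o, holders S o \notin f @: J])).
    apply: eq_bigl => S; apply/forall_inP/forallP => [H o|H e eJ].
      apply/imsetP => -[e eJ] He; have /forallP/(_ o) := H _ eJ.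
      by rewrite He eqxx.
    apply/forallP => o; apply: contra (H o) => /eqP ->; exact: imset_f.
  rewrite (Gb_event_prob_forall p (fun o H => H \notin f @: J)).
  by rewrite holder_probC// betaE prodr_const card_ord.
rewrite -exprM mulnC exprM; apply: lerXn2r; rewrite ?nnegrE.
- by rewrite -betaE -holder_probC// holder_prob_ge0.
- rewrite exprn_ge0// subr_ge0.
  have /andP[q0 q1] := p01.
  by rewrite mulr_ile1 ?exprn_ge0 ?exprn_ile1 ?subr_ge0 // lerBlDr lerDl.
- apply: Bernoulli_ineq; have /andP[q0 q1] := p01.
  rewrite mulr_ge0 ?exprn_ge0 ?subr_ge0//=.
  by rewrite mulr_ile1 ?exprn_ge0 ?exprn_ile1 ?subr_ge0 // lerBlDr lerDl.
Qed.

Lemma mean_unused_pairs (T : {set 'I_n}) :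
  \sum_S object_sets_pmf p S * \prod_(i in T) \prod_(j in ~: T)
     (if pair_unused S (i, j) then 1 else x) <=
  (x + (1 - x) * (1 - beta) ^+ P) ^+ (n - #|T|) ^+ #|T|.
Proof.
pose q := (1 - beta) ^+ P; pose F := finset.setX T (~: T).
(* The values 0 and 1 outside [F] extend the product to all pairs without changing it, and make the
   coefficient of every [J] not contained in [F] vanish. *)
pose f e : R := if e \in F then 1 - x else 0.
pose g e : R := if e \in F then x else 1.
have f0 e : 0 <= f e by rewrite /f; case: ifP.
have g0 e : 0 <= g e by rewrite /g; case: ifP => // _; exact: ltW.
have pairE (h : 'I_n * 'I_n -> R) :
    \prod_(i in T) \prod_(j in ~: T) h (i, j) = \prod_(e in F) h e.
  rewrite pair_big/=; apply: eq_big => [[i j]|[i j] _//].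
  by rewrite !inE.
rewrite (_ : (x + _) ^+ _ ^+ _ = \prod_e (f e * q + g e)); last first.
  rewrite (bigID (mem F))/= [X in _ = _ * X]big1 ?mulr1.
    rewrite (eq_bigr (fun=> x + (1 - x) * q)); last first.
      by move=> e eF; rewrite /f /g eF addrC.
    rewrite prodr_const -exprM; congr (_ ^+ _).
    rewrite cardsX; have := cardsC T; rewrite card_ord => eT.
    have -> : (n - #|T| = #|~: T|)%N by lia.
    by rewrite mulnC.
  by move=> e /negbTE eF; rewrite /f /g eF mul0r add0r.
rewrite [leRHS](@bigA_distr R 0 1 *%R +%R)/=.
pose c (J : {set 'I_n * 'I_n}) := \prod_e (if e \in J then f e else g e).
have -> : \sum_S object_sets_pmf p S * \prod_(i in T) \prod_(j in ~: T)
     (if pair_unused S (i, j) then 1 else x) =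
   \sum_(J : {set 'I_n * 'I_n}) c J *
     Gb_event_prob (P := P) p (fun S => [forall e in J, pair_unused S e]).
  transitivity (\sum_(S : {ffun 'I_n -> {set 'I_P}}) \sum_(J : {set 'I_n * 'I_n})
     c J * (if [forall e in J, pair_unused S e] then object_sets_pmf p S else 0)).
    apply: eq_bigr => S _.
    rewrite (pairE (fun e => if pair_unused S e then 1 else x)).
    rewrite (_ : \prod_(e in F) _ =
       \prod_e (f e * (pair_unused S e)%:R + g e)); last first.
      rewrite [RHS](bigID (mem F))/= [X in _ = _ * X]big1 ?mulr1.
        apply: eq_bigr => e eF; rewrite /f /g eF.
        by case: pair_unused; rewrite ?mulr1 ?mulr0 ?subrK ?add0r.
      by move=> e /negbTE eF; rewrite /f /g eF mul0r add0r.
    rewrite (@bigA_distr R 0 1 *%R +%R)/= big_distrr/=; apply: eq_bigr => J _.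
    rewrite mulrC; case: ifPn => [/forall_inP H|].
      congr (_ * _); apply: eq_bigr => e _; case: ifP => // eJ.
      by rewrite H// mulr1.
    rewrite negb_forall => /existsP[e]; rewrite negb_imply => /andP[eJ /negbTE ue].
    by rewrite (bigD1 e)//= eJ ue mulr0 mul0r mulr0 mul0r.
  rewrite exchange_big/=; apply: eq_bigr => J _.
  by rewrite -big_distrr/= /Gb_event_prob -big_mkcond.
apply: ler_sum => J _.
have [JF|/fintype.subsetPn[e eJ eF]] := boolP (J \subset F); last first.
  rewrite {1}/c (bigD1 e)//= eJ {1}/f (negbTE eF) !mul0r.
  apply: prodr_ge0 => e' _; case: ifP => _ //; apply: mulr_ge0 => //.
  rewrite /q exprn_ge0// subr_ge0; have /andP[q0 q1] := p01.
  by rewrite mulr_ile1 ?exprn_ge0 ?exprn_ile1 ?subr_ge0 // lerBlDr lerDl.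
rewrite [leRHS](_ : _ = c J * q ^+ #|J|).
  apply: ler_wpM2l; first by apply: prodr_ge0 => e _; case: ifP.
  exact: Gb_event_prob_pairs_unused JF.
rewrite /c (bigID (mem J))/= [in RHS](bigID (mem J))/= mulrAC; congr (_ * _); last first.
  by apply: eq_bigr => e /negbTE ->.
rewrite -[in RHS]prodr_const -big_split/=.
by apply: eq_bigr => e ->.
Qed.

Definition sparse_cut (l : nat) (T : {set 'I_n}) S :=
  [forall i in T, (#|[set j in ~: T | intersection_adj S i j]| <= l)%N].

(** Markov's inequality for the product in [mean_unused_pairs]: on the event, each node of [T]
    contributes at least [x ^+ l] to it, since at most [l] of its pairs can be used. *)
Lemma Gb_event_prob_sparse_cut (l : nat) (T : {set 'I_n}) :
  Gb_event_prob (P := P) p (sparse_cut l T) <=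
  (x ^- l * (x + (1 - x) * (1 - beta) ^+ P) ^+ (n - #|T|)) ^+ #|T|.
Proof.
rewrite exprMn exprVn.
apply: le_trans (ler_wpM2l _ (mean_unused_pairs T)); last first.
  by rewrite invr_ge0 !exprn_ge0// ltW.
rewrite mulrC ler_pdivlMr ?exprn_gt0// [leLHS]mulrC /Gb_event_prob big_distrr/=.
rewrite [leLHS]big_mkcond/=; apply: ler_sum => S _.
have Q0 : 0 <= \prod_(i in T) \prod_(j in ~: T)
    (if pair_unused S (i, j) then 1 else x).
  apply: prodr_ge0 => i _; apply: prodr_ge0 => j _; case: ifP => // _.
  exact: ltW.
case: ifP => [/forall_inP badS|_]; last first.
  by rewrite mulr_ge0 ?object_sets_pmf_ge0.
rewrite mulrC; apply: ler_wpM2l; first exact: object_sets_pmf_ge0.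
rewrite -prodr_const; apply: ler_prod => i iT.
apply/andP; split; first by rewrite exprn_ge0// ltW.
(* A used pair is adjacent, so replacing used by adjacent only lowers the product, as [x <= 1]. *)
apply: (@le_trans _ _ (\prod_(j in ~: T) (if intersection_adj S i j then x else 1))).
  rewrite -big_mkcondr/= prodr_const; apply: ler_wiXn2l; rewrite ?(ltW x0)//.
    by case/andP: x01.
  apply: leq_trans (badS i iT); apply: subset_leq_card; apply/fintype.subsetP => j.
  by rewrite unfold_in [in X in _ -> X]inE.
apply: ler_prod => j; rewrite inE => jT; case: ifPn => [_|adj].
  rewrite (ltW x0)/=; case: ifP => // _; by case/andP: x01.
by rewrite ler01/= pair_unused_adj//; apply: contraNneq jT => <-.
Qed.

End SparseCut.

(** * Union bound over cuts *)

(** A violation of robustness is symmetric in [T] and its complement, so the smaller side can be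
    taken. *)
Lemma not_k_robust_sparse_cut (n P k : nat) (S : {ffun 'I_n -> {set 'I_P}}) :
  ~~ k_robust (intersection_adj S) k ->
  exists T : {set 'I_n}, [/\ (0 < #|T|)%N, (2 * #|T| <= n)%N & sparse_cut k.-1 T S].
Proof.
rewrite negb_forall => /existsP[T].
rewrite negb_imply negb_or => /andP[/andP[T0 TT] /andP[]].
rewrite !negb_exists_in => /forall_inP cutT /forall_inP cutC.
have cardT : (#|T| + #|~: T|)%N = n by rewrite cardsC card_ord.
have [le_n|gt_n] := leqP (2 * #|T|) n.
  exists T; split=> //; first by rewrite card_gt0.
  apply/forall_inP => i iT; have := cutT i iT; rewrite -ltnNge.
  by case: (k).
exists (~: T); split; last first.
- apply/forall_inP => i iT; have := cutC i iT; rewrite -ltnNge finset.setCK.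
  by case: (k).
- by move: cardT gt_n; move: #|T| #|~: T| => a b; lia.
- rewrite card_gt0; apply: contra TT => /eqP CT.
  by rewrite -(finset.setCK T) CT finset.setC0.
Qed.

Lemma sum_by_card (R : realType) (n : nat) (q : pred nat) (g : nat -> R) :
  \sum_(T : {set 'I_n} | q #|T|) g #|T| = \sum_(t < n.+1 | q t) 'C(n, t)%:R * g t.
Proof.
have ltT (T : {set 'I_n}) : (#|T| < n.+1)%N.
  by rewrite ltnS -[leqRHS](card_ord n) max_card.
rewrite (partition_big (fun T : {set 'I_n} => Ordinal (ltT T)) (fun t => q t))//=.
apply: eq_bigr => t qt.
rewrite (eq_bigl (fun T : {set 'I_n} => T \in [set T : {set 'I_n} | #|T| == t])).
  rewrite (eq_bigr (fun=> g t)).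
    by rewrite sumr_const card_draws card_ord mulr_natl.
  by move=> T; rewrite inE => /eqP ->.
move=> T; rewrite inE -val_eqE/=; case: eqP => [->|_]; last by rewrite andbF.
by rewrite qt.
Qed.

Lemma Gb_probC (R : realType) (n P : nat) (p : R) (E : rel 'I_n -> bool) :
  1 - Gb_prob P p E =
  Gb_event_prob (P := P) p (fun S => ~~ E (intersection_adj S)).
Proof.
rewrite -(Gb_prob_total n P p) /Gb_prob /Gb_event_prob.
rewrite (bigID (fun S : {ffun 'I_n -> {set 'I_P}} => E (intersection_adj S)))/=.
by rewrite addrAC subrr add0r.
Qed.

Lemma Gb_prob_not_k_robust_le (R : realType) (n P k : nat) (p x : R) :
  0 <= p <= 1 -> 0 < x <= 1 ->
  1 - Gb_prob P p (fun adj : rel 'I_n => k_robust adj k) <=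
  \sum_(t < n.+1 | (0 < t)%N && (2 * t <= n)%N) 'C(n, t)%:R *
    (x ^- k.-1 * (x + (1 - x) * (1 - p ^+ 2 * (1 - p) ^+ (n - 2)) ^+ P) ^+ (n - t)) ^+ t.
Proof.
move=> p01 x01; rewrite Gb_probC.
rewrite -(sum_by_card _ (fun t => (0 < t)%N && (2 * t <= n)%N) (fun t => (x ^- k.-1 * (x + (1 - x) *
  (1 - p ^+ 2 * (1 - p) ^+ (n - 2)) ^+ P) ^+ (n - t)) ^+ t)).
apply: (@le_trans _ _ (\sum_(T : {set 'I_n} | (0 < #|T|)%N && (2 * #|T| <= n)%N)
   Gb_event_prob (P := P) p (sparse_cut k.-1 T))); last first.
  by apply: ler_sum => T _; exact: Gb_event_prob_sparse_cut.
rewrite /Gb_event_prob.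
under [leRHS]eq_bigr do rewrite big_mkcond/=.
rewrite exchange_big/= big_mkcond/=; apply: ler_sum => S _.
have pmf0 := object_sets_pmf_ge0 S p01.
case: ifPn => [/not_k_robust_sparse_cut[T [T0 Tn cutT]]|_].
  rewrite (bigD1 T) ?T0 ?Tn//= cutT lerDl.
  by apply: sumr_ge0 => U _; case: ifP.
by apply: sumr_ge0 => U _; case: ifP.
Qed.

(** * Elementary estimates *)

Lemma ffact_le_expn (n t : nat) : (n ^_ t <= n ^ t)%N.
Proof.
elim: t n => [|t IH] [|n]; rewrite ?ffactn0 ?ffact0n //.
rewrite ffactSS expnS leq_mul2l/=; apply: leq_trans (IH n) _.
by case: t {IH} => // t; rewrite leq_exp2r.
Qed.

(** Combines ['C(n, t) * t! <= n ^ t] with [t ^ t / t! <= e ^ t], the latter because a single term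
    of the exponential series is below its sum. *)
Lemma bin_le_expR (R : realType) (n t : nat) : (0 < t)%N ->
  'C(n, t)%:R <= (expR 1 * n%:R / t%:R) ^+ t :> R.
Proof.
case: t => // t _.
have tn0 : 0 < t.+1%:R ^+ t.+1 :> R by rewrite exprn_gt0// ltr0n.
have fact0 : 0 < (t.+1)`!%:R :> R by rewrite ltr0n fact_gt0.
have e1 : t.+1%:R ^+ t.+1 <= (t.+1)`!%:R * expR 1 ^+ t.+1 :> R.
  have := @expR_ge1Dxn R t.+1%:R t (ler0n _ _).
  rewrite -[X in expR X]mulr1 expRM_natl => le1.
  by rewrite mulrC -ler_pdivrMr//; apply: le_trans le1; rewrite lerDr.
have e2 : 'C(n, t.+1)%:R * (t.+1)`!%:R <= n%:R ^+ t.+1 :> R.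
  by rewrite -natrM bin_ffact -natrX ler_nat ffact_le_expn.
rewrite exprMn exprVn exprMn ler_pdivlMr// -(ler_pM2r fact0) mulrAC.
apply: (@le_trans _ _ (n%:R ^+ t.+1 * t.+1%:R ^+ t.+1)).
  by rewrite ler_wpM2r// ltW.
rewrite [leRHS](_ : _ = n%:R ^+ t.+1 * ((t.+1)`!%:R * expR 1 ^+ t.+1)); last by ring.
by rewrite ler_wpM2l// exprn_ge0.
Qed.

Lemma geometric_sum_le (R : realType) (y : R) (n : nat) (q : pred nat) :
  0 <= y -> y <= 1 / 2 -> (forall t, q t -> (0 < t)%N) ->
  \sum_(t < n.+1 | q t) y ^+ t <= 2 * y.
Proof.
move=> y0 y1 q0.
apply: (@le_trans _ _ (\sum_(t < n.+1 | (0 < t)%N) y ^+ t)).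
  rewrite big_mkcond [leRHS]big_mkcond/=; apply: ler_sum => t _.
  case: ifP => [/q0->//|_]; case: ifP => // _; exact: exprn_ge0.
rewrite big_mkcond big_ord_recl/= add0r.
under eq_bigr do rewrite exprS.
rewrite -big_distrr/= mulrC ler_wpM2r//.
have := GRing.subrX1 y n; have : 0 <= y ^+ n by rewrite exprn_ge0.
have : 0 <= \sum_(i < n) y ^+ i by apply: sumr_ge0 => i _; rewrite exprn_ge0.
set s := \sum_(i < n) _ => s0 yn e; nra.
Qed.

(** Since [exp (- u) <= 1 / (1 + u)], the right side is at least [u / (1 + u)]. *)
Lemma onesub_expRN_ge (R : realType) (u : R) : 0 <= u -> u - u ^+ 2 <= 1 - expR (- u).
Proof.
move=> u0; have := expRxMexpNx_1 u; have := expR_ge1Dx u.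
have := expR_gt0 (- u); set v := expR (- u); set w := expR u => v0 w1 wv.
have : 0 <= u ^+ 3 by rewrite exprn_ge0.
have : v * (1 + u) <= 1 by nra.
by nra.
Qed.

Lemma onesub_exp_le_expR (R : realType) (u : R) (m : nat) : u <= 1 ->
  (1 - u) ^+ m <= expR (- (m%:R * u)).
Proof.
move=> u1; rewrite -mulrN expRM_natl lerXn2r ?nnegrE ?expR_ge0 ?subr_ge0//.
exact: expR_ge1Dx.
Qed.

Lemma onesub3_ge (R : realType) (x y z : R) : 0 <= x <= 1 -> 0 <= y <= 1 -> 0 <= z <= 1 ->
  1 - x - y - z <= (1 - x) * ((1 - y) * (1 - z)).
Proof.
move=> /andP[x0 x1] /andP[y0 y1] /andP[z0 z1].
have h : 1 - y - z <= (1 - y) * (1 - z) by nra.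
by apply: le_trans (ler_wpM2l _ h); nra.
Qed.

(** With [c = (1 - p)^(n - 2)], a given pair is the holder set of [b c] objects on average, and the
    probability that there is one is at least [b c (1 - b c)]. The factor [1 - n p] bounds [c] from
    below, and [1 - b] pays for repeated objects. *)
Lemma pair_used_prob_ge (R : realType) (n P : nat) (p : R) (b := p ^+ 2 * P%:R) :
  0 <= p <= 1 -> n%:R * p <= 1 -> b <= 1 ->
  b * ((1 - n%:R * p) * (1 - b)) <= 1 - (1 - p ^+ 2 * (1 - p) ^+ (n - 2)) ^+ P.
Proof.
move=> p01 np1 b1; have /andP[p0 p1] := p01.
pose c := (1 - p) ^+ (n - 2).
have c1 : c <= 1 by rewrite exprn_ile1 ?subr_ge0// lerBlDr lerDl.
have c0 : 0 <= c by rewrite exprn_ge0// subr_ge0.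
have cn : 1 - n%:R * p <= c.
  apply: le_trans (Bernoulli_ineq (n - 2) p01).
  by rewrite lerB// ler_wpM2r// ler_nat leq_subr.
have b0 : 0 <= b by rewrite mulr_ge0 ?exprn_ge0.
have p2 : p ^+ 2 <= 1 by rewrite exprn_ile1.
have p20 : 0 <= p ^+ 2 by rewrite exprn_ge0.
have /(@onesub_exp_le_expR R _ P) : p ^+ 2 * c <= 1 by rewrite mulr_ile1.
rewrite -/c (_ : P%:R * _ = b * c); last by rewrite /b; ring.
have bc0 : 0 <= b * c by rewrite mulr_ge0.
have := onesub_expRN_ge bc0.
move=> h1 h2; apply: le_trans (_ : b * c - (b * c) ^+ 2 <= _); last by lra.
rewrite [leRHS](_ : _ = b * (c * (1 - b * c))); last by ring.
apply: ler_wpM2l => //; apply: ler_pM => //; rewrite ?subr_ge0//.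
by rewrite lerB// ler_piMr.
Qed.

(** * Finite bound above the threshold *)

Section SupercriticalBound.
Variables (R : realType) (n P l : nat) (p alpha : R).
Variables N L b : R.
Hypothesis NE : N = n%:R.
Hypothesis LE : L = ln N.
Hypothesis b_def : b = p ^+ 2 * P%:R.
Hypothesis n2 : (1 < n)%N.
Hypothesis p01 : 0 <= p <= 1.
Hypothesis L8 : 8 <= L.
Hypothesis L2N : 4 * L ^+ 2 <= N.
Hypothesis bE : N * b = L + l%:R * ln L + alpha.
Hypothesis b_le : N * b <= 5 / 4 * L.
Hypothesis npL : N * p * L <= 1.

Let p0 : 0 <= p. Proof. by case/andP: p01. Qed.
Let N0 : 0 < N. Proof. by rewrite NE ltr0n; apply: ltn_trans n2. Qed.
Let b0 : 0 <= b. Proof. by rewrite b_def mulr_ge0 ?exprn_ge0. Qed.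
Let q := (1 - p ^+ 2 * (1 - p) ^+ (n - 2)) ^+ P.

(** With [x = 1 / L], replacing the true exponent by [(n - t) b] costs at most
    [N b (1 / L + N p + b)]. The three products are at most [5 / 4], [5 / 4] and [1 / 2], which add
    up to 3. *)
Lemma cut_exponent_le (t : nat) : (t <= n)%N ->
  (n - t)%:R * b - (n - t)%:R * ((1 - L^-1) * (1 - q)) <= 3.
Proof.
move: (L8) (L2N) (bE) (b_le) (npL) (N0) (b0) (p0) => hL8 hL2N hb hble hnpL hN0 hb0 hp0.
move=> tn; have Np0 : 0 <= N * p by rewrite mulr_ge0// ltW.
have L0 : 0 < L by apply: lt_le_trans L8.
have LL : L * L^-1 = 1 by rewrite mulfV// gt_eqF//.
have Li0 : 0 < L^-1 by rewrite invr_gt0.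
have Li1 : L^-1 <= 1 by rewrite invf_le1//; lra.
have Np1 : N * p <= 1 by nra.
have Nb0 : 0 <= N * b by rewrite mulr_ge0// ltW.
have Nb2 : N * b * (N * b) <= N.
  by apply: le_trans (ler_pM Nb0 Nb0 b_le b_le) _; nra.
have b1 : b <= 1.
  have : 1 <= N by rewrite NE ler1n; apply: ltn_trans n2.
  nra.
have used : b * ((1 - N * p) * (1 - b)) <= 1 - q.
  by rewrite NE b_def; apply: pair_used_prob_ge; rewrite -?NE -?b_def.
have h : b - (1 - L^-1) * (1 - q) <= b * (L^-1 + N * p + b).
  have h1 := @onesub3_ge R L^-1 (N * p) b.
  have h2 : 1 - L^-1 - N * p - b <= (1 - L^-1) * ((1 - N * p) * (1 - b)).
    by apply: h1; apply/andP; split => //; exact: ltW.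
  have h3 : b * (1 - L^-1 - N * p - b) <= b * ((1 - L^-1) * ((1 - N * p) * (1 - b))).
    by rewrite ler_wpM2l.
  have h4 : (1 - L^-1) * (b * ((1 - N * p) * (1 - b))) <= (1 - L^-1) * (1 - q).
    by rewrite ler_wpM2l// subr_ge0.
  rewrite mulrCA in h4; lra.
rewrite -mulrBr; apply: le_trans (ler_wpM2l _ h) _ => //.
apply: (@le_trans _ _ (N * (b * (L^-1 + N * p + b)))).
  apply: ler_wpM2r; first by rewrite mulr_ge0// !addr_ge0// ltW.
  by rewrite NE ler_nat leq_subr.
rewrite mulrA !mulrDr.
have t1 : N * b * L^-1 <= 5 / 4.
  by rewrite ler_pdivrMr//; lra.
have t2 : N * b * (N * p) <= 5 / 4.
  apply: le_trans (ler_wpM2r _ b_le) _ => //; nra.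
have t3 : N * b * b <= 1 / 2.
  rewrite -(ler_pM2l N0) mulrCA; apply: (@le_trans _ _ ((5 / 4 * L) * (5 / 4 * L))); last by nra.
  by apply: ler_pM.
lra.
Qed.

(** Here [x ^- l = exp (l ln L)], and [l ln L = N b - L - alpha]. The term [N b] cancels against the
    exponent [- (N - t) b] of the second factor, leaving [exp (- alpha) / N] and [exp (t b)], up to
    the loss [exp 3]. *)
Lemma cut_base_le (t : nat) : (t <= n)%N ->
  L^-1 ^- l * (L^-1 + (1 - L^-1) * q) ^+ (n - t) <=
  expR (3 - alpha) / N * expR (t%:R * b).
Proof.
move: (L8) (L2N) (bE) (b_le) (npL) (N0) (b0) (p0) => hL8 hL2N hb hble hnpL hN0 hb0 hp0.
move=> tn; have L0 : 0 < L by lra.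
have Li0 : 0 <= 1 - L^-1 by rewrite subr_ge0 invf_le1//; lra.
have q0 : 0 <= q.
  rewrite exprn_ge0// subr_ge0; have /andP[_ p1] := p01.
  by rewrite mulr_ile1 ?exprn_ge0 ?exprn_ile1 ?subr_ge0 // lerBlDr lerDl.
rewrite (_ : L^-1 + _ = 1 - (1 - L^-1) * (1 - q)); last by ring.
have u1 : (1 - L^-1) * (1 - q) <= 1.
  apply: (@le_trans _ _ ((1 - L^-1) * 1)).
    by rewrite ler_wpM2l// lerBlDr lerDl.
  by rewrite mulr1 lerBlDr lerDl invr_ge0 ltW.
have := @onesub_exp_le_expR R _ (n - t) u1 => h.
rewrite -exprVn invrK -[X in X ^+ l](@lnK _ L) ?posrE// -expRM_natl.
apply: le_trans (ler_wpM2l (expR_ge0 _) h) _.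
rewrite -[in X in _ / X](@lnK _ N) ?posrE// -LE -expRB -!expRD ler_expR.
have := cut_exponent_le tn; rewrite natrB// -NE => h'.
rewrite (_ : l%:R * ln L = N * b - L - alpha); last by rewrite bE; ring.
lra.
Qed.

(** The factor [t] is what the binomial bound [(e n / t)^t] can absorb. In logarithms the claim is
    [t b <= 1 + ln t], where [b] is at most [5 / 4 * L / N]. *)
Lemma expR_cut_le (t : nat) : (0 < t)%N -> (2 * t <= n)%N -> expR (t%:R * b) <= expR 1 * t%:R.
Proof.
move: (L8) (L2N) (bE) (b_le) (npL) (N0) (b0) (p0) => hL8 hL2N hb hble hnpL hN0 hb0 hp0.
move=> t0 tn; have t0' : 0 < t%:R :> R by rewrite ltr0n.
rewrite -[X in _ <= _ * X](@lnK _ t%:R) ?posrE// -expRD ler_expR.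
have lnt0 : 0 <= ln t%:R :> R by rewrite ln_ge0// ler1n.
have tN : 2 * t%:R <= N by rewrite NE -natrM ler_nat.
have tb : N * (t%:R * b) <= t%:R * (5 / 4 * L) by rewrite mulrCA ler_wpM2l.
rewrite -(ler_pM2l N0).
(* For [t^2 <= N], the bound [4 L^2 <= N] gives [t L <= N / 2], hence already [t b <= 1]. *)
have [tsq|tsq] := leP (t%:R ^+ 2) N.
  have : (t%:R * L) ^+ 2 <= (N / 2) ^+ 2.
    rewrite exprMn expr_div_n; have := sqr_ge0 L; nra.
  rewrite ler_sqr ?nnegrE ?divr_ge0 ?mulr_ge0//; [|lra..].
  move=> h; have : 0 <= N * ln t%:R by rewrite mulr_ge0// ltW.
  nra.
have lnt : L <= 2 * ln t%:R.
  rewrite LE mulr_natl -lnXn// ler_ln ?posrE ?exprn_gt0//; exact: ltW.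
(* Up to [t = N / 4], [t b] is at most [5 / 16 * L], below [L / 2 <= ln t]. *)
have [t4|t4] := leP (4 * t%:R) N; first by nra.
(* For larger [t], [ln t] is within [ln 4] of [L], whereas [t b <= 5 / 8 * L] because [t <= N / 2];
   [L >= 8] leaves enough room. *)
have ln4 : ln (4 : R) <= 3 by have := @le_ln1Dx R 3; rewrite (_ : 1 + 3 = 4 :> R); [apply; lra|lra].
have lnt' : L <= ln t%:R + 3.
  apply: (@le_trans _ _ (ln (4 * t%:R))).
    rewrite LE ler_ln ?posrE ?mulr_gt0//; exact: ltW.
  by rewrite lnM ?posrE// addrC lerD2l.
nra.
Qed.

Lemma Gb_prob_k_robust_ge :
  expR (5 - alpha) <= 1 / 2 ->
  1 - 2 * expR (5 - alpha) <= Gb_prob P p (fun adj : rel 'I_n => k_robust adj l.+1).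
Proof.
move: (L8) (L2N) (bE) (b_le) (npL) (N0) (b0) (p0) => hL8 hL2N hb hble hnpL hN0 hb0 hp0.
move=> y1; set y := expR _ in y1 *.
have y0 : 0 <= y by exact: expR_ge0.
have Lx : 0 < L^-1 <= 1 by rewrite invr_gt0 invf_le1; lra.
rewrite lerBlDr -lerBlDl.
apply: le_trans (Gb_prob_not_k_robust_le _ _ _ p01 Lx) _.
apply: (@le_trans _ _ (\sum_(t < n.+1 | (0 < t)%N && (2 * t <= n)%N) y ^+ t)); last first.
  by apply: (@geometric_sum_le R y n (fun t => (0 < t)%N && (2 * t <= n)%N)) => // t /andP[].
apply: ler_sum => t /andP[t0 tn].
have tn' : (t <= n)%N by rewrite -ltnS.
have t0' : 0 < t%:R :> R by rewrite ltr0n.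
apply: le_trans (ler_wpM2r _ (bin_le_expR R n t0)) _.
  rewrite !exprn_ge0// mulr_ge0// ?exprn_ge0 ?invr_ge0 ?exprn_ge0 ?invr_ge0//; first lra.
  rewrite addr_ge0 ?invr_ge0 ?mulr_ge0 ?subr_ge0//; [lra|by case/andP: Lx|].
  rewrite exprn_ge0// subr_ge0; have /andP[_ p1] := p01.
  by rewrite mulr_ile1 ?exprn_ge0 ?exprn_ile1 ?subr_ge0 // lerBlDr lerDl.
rewrite -exprMn lerXn2r ?nnegrE//.
  rewrite !mulr_ge0 ?expR_ge0 ?invr_ge0//; first by rewrite exprn_ge0// invr_ge0; lra.
  rewrite exprn_ge0// addr_ge0 ?invr_ge0 ?mulr_ge0 ?subr_ge0//; [lra|by case/andP: Lx|].
  rewrite exprn_ge0// subr_ge0; have /andP[_ p1] := p01.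
  by rewrite mulr_ile1 ?exprn_ge0 ?exprn_ile1 ?subr_ge0 // lerBlDr lerDl.
apply: le_trans (ler_wpM2l _ (cut_base_le tn')) _.
  by rewrite !mulr_ge0 ?expR_ge0 ?invr_ge0.
apply: le_trans (ler_wpM2l _ (ler_wpM2l _ (expR_cut_le t0 tn))) _.
- by rewrite !mulr_ge0 ?expR_ge0 ?invr_ge0.
- by rewrite !mulr_ge0 ?expR_ge0 ?invr_ge0// ltW.
(* The factors [N] and [t] cancel. The 5 is the 3 from the cut plus one [e] from the binomial
   coefficient and one from [expR_cut_le]. *)
rewrite [leLHS](_ : _ = expR 1 * expR (3 - alpha) * expR 1).
  by rewrite /y -!expRD ler_expR; lra.
by rewrite -NE; field; rewrite !gt_eqF.
Qed.

End SupercriticalBound.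

(** * Nodes of low degree *)

Definition paired (n : nat) (i : 'I_n) (H : {set 'I_n}) := (i \in H) && (#|H| == 2).

(** An object held by [i] alone is allowed, since it creates no edge. *)
Definition unshared (n : nat) (i : 'I_n) (H : {set 'I_n}) := ~~ ((i \in H) && (1 < #|H|)%N).

Definition link_test (n P : nat) (A : {set 'I_P}) (i : 'I_n) (o : 'I_P) (H : {set 'I_n}) :=
  if o \in A then paired i H else unshared i H.

(* [A] is exactly the set of objects that [i] shares, each with one other node. *)
Definition links_exactly (n P : nat) (A : {set 'I_P}) (i : 'I_n)
    (S : {ffun 'I_n -> {set 'I_P}}) :=
  [forall o, link_test A i o (holders S o)].

Definition has_links (n P l : nat) (i : 'I_n) (S : {ffun 'I_n -> {set 'I_P}}) :=
  [exists A : {set 'I_P}, (#|A| == l) && links_exactly A i S].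

(** [A] can be read off from the holder sets, so the events for different [A] are disjoint and their
    probabilities add up exactly. *)
Lemma links_exactly_inj (n P : nat) (A B : {set 'I_P}) (i : 'I_n)
    (S : {ffun 'I_n -> {set 'I_P}}) :
  links_exactly A i S -> links_exactly B i S -> A = B.
Proof.
move=> /forallP SA /forallP SB; apply/setP => o.
have := SA o; have := SB o; rewrite /link_test /paired /unshared.
by do 2 case: ifP => //; move=> _ _; case: (i \in _) => //=; case: eqP => // ->.
Qed.

(** An object shared with a neighbour has at least two holders, hence lies in [A], and each object
    of [A] has only one holder besides [i]. Two of them may give the same neighbour, hence only an
    inequality. *)
Lemma has_links_degree (n P l : nat) (i : 'I_n) (S : {ffun 'I_n -> {set 'I_P}}) :
  has_links l i S -> (#|[set j | intersection_adj S i j]| <= l)%N.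
Proof.
move=> /existsP[A /andP[/eqP <- /forallP SA]].
apply: (@leq_trans #|\bigcup_(o in A) (holders S o :\ i)|).
  apply: subset_leq_card; apply/fintype.subsetP => j; rewrite inE => /andP[ij].
  move=> /set0Pn[ o]; rewrite inE => /andP[oi oj].
  apply/bigcupP; exists o; last by rewrite !inE eq_sym ij oj.
  apply: contraT => oA; have := SA o; rewrite /link_test (negbTE oA) /unshared inE oi/=.
  have : ([set i; j] \subset holders S o).
    by apply/fintype.subsetP => x; rewrite !inE => /orP[]/eqP->.
  by move=> /subset_leq_card; rewrite cards2 ij => ->.
rewrite -[leqRHS]sum1_card; apply: (big_ind2 (fun (U : {set 'I_n}) m => (#|U| <= m)%N)).
- by rewrite cards0.
- by move=> U u V v Uu Vv; apply: leq_trans (leq_add Uu Vv); rewrite cardsU leq_subr.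
- move=> o oA; have := SA o; rewrite /link_test oA => /andP[io /eqP H2].
  by move: H2; rewrite (cardsD1 i) io add1n => -[->].
Qed.

(** Robustness is applied to [[set x]]. Its second alternative counts neighbours inside a singleton,
    which forces [k <= 1], and for [k = 1] exhibits a neighbour of [x]. *)
Lemma k_robust_degree (V : finType) (adj : rel V) (k : nat) (x : V) :
  symmetric adj -> irreflexive adj -> (1 < #|V|)%N ->
  k_robust adj k -> (k <= #|[set y | adj x y]|)%N.
Proof.
move=> adjC adjxx V1 /forallP/(_ [set x])/implyP.
have -> : ([set x] != finset.set0) && ([set x] != [set: V]).
  apply/andP; split; first by apply/set0Pn; exists x; rewrite inE.
  by apply/eqP => xT; move: V1; rewrite -cardsT -xT cards1.
move=> /(_ isT)/orP[] /exists_inP[y]; rewrite !inE.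
  move=> /eqP->; move=> /leq_trans; apply; apply: subset_leq_card.
  by apply/fintype.subsetP => z; rewrite !inE => /andP[].
move=> yx ky; have [xy|xy] := boolP (adj x y); last first.
  move: ky; rewrite (_ : #|_| = 0%N) ?leqn0 => [/eqP->//|].
  apply/eqP; rewrite cards_eq0; apply/eqP/setP => z; rewrite !inE.
  by apply/andP => -[/eqP->]; rewrite adjC (negbTE xy).
apply: (leq_trans ky); apply: (@leq_trans 1%N).
  by rewrite -(cards1 x); apply/subset_leq_card/fintype.subsetP => z; rewrite !inE => /andP[].
by rewrite card_gt0; apply/set0Pn; exists y; rewrite inE.
Qed.

(** * Probabilities of links at one and at two nodes *)

Section LinkLaw.
Variables (R : realType) (n P : nat) (p : R).
Hypothesis p01 : 0 <= p <= 1.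
Implicit Types (i j : 'I_n) (A B : {set 'I_P}).

Let p0 : 0 <= p. Proof. by case/andP: p01. Qed.
Let p1 : 0 <= 1 - p. Proof. by rewrite subr_ge0; case/andP: p01. Qed.

Lemma holder_prob_mkcond (q : pred {set 'I_n}) :
  holder_prob p q = \sum_H (if q H then holder_pmf p H else 0).
Proof. exact: big_mkcond. Qed.

Lemma holder_prob_paired i :
  holder_prob p (paired i) = (n%:R - 1) * (p ^+ 2 * (1 - p) ^+ (n - 2)).
Proof.
pose f j := [set i; j]; pose D := ~: [set i].
have finj : {in D &, injective f}.
  move=> j j'; rewrite !inE => ji j'i /setP/(_ j).
  by rewrite !inE eqxx orbT (negbTE ji) => /esym/eqP.
rewrite /holder_prob (eq_bigl (fun H => H \in f @: D)).
  rewrite (eq_bigr (fun=> p ^+ 2 * (1 - p) ^+ (n - 2))).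
    rewrite sumr_const card_in_imset// cardsC1 card_ord -[LHS]mulr_natl.
    by rewrite -subn1 natrB//; case: (n) (i) => [[]|].
  by move=> H /imsetP[j]; rewrite !inE => ji ->; rewrite holder_pmf_pair// eq_sym.
move=> H; apply/andP/imsetP => [[iH /cards2P[x [y [xy HE]]]]|[j]].
  move: iH; rewrite HE !inE => /orP[]/eqP ii.
    by exists y; rewrite ?inE /f ii// eq_sym.
  by exists x; rewrite ?inE /f ii// finset.setUC.
by rewrite !inE => ji ->; rewrite !inE eqxx cards2 eq_sym ji.
Qed.

Lemma holder_prob_mem i : holder_prob p (fun H => i \in H) = p.
Proof.
rewrite -[RHS]expr1 -(cards1 i) -holder_prob_subset.
by apply: eq_bigl => H; rewrite finset.sub1set.
Qed.

Lemma holder_prob_mem2 i j : i != j -> holder_prob p (fun H => (i \in H) && (j \in H)) = p ^+ 2.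
Proof.
move=> ij; have := holder_prob_subset p [set i; j]; rewrite cards2 ij => <-.
by apply: eq_bigl => H; rewrite finset.subUset !finset.sub1set.
Qed.

Lemma holder_prob_unshared i :
  holder_prob p (unshared i) = 1 - p + p * (1 - p) ^+ (n - 1).
Proof.
rewrite holder_probC// -addrA; congr (_ + _); apply/eqP; rewrite eqr_oppLR opprD opprK; apply/eqP.
rewrite -[X in _ = X - _](holder_prob_mem i) /holder_prob.
rewrite [in RHS](bigID (fun H : {set 'I_n} => 1 < #|H|)%N)/= -addrA -[LHS]addr0.
congr (_ + _); apply/esym/eqP; rewrite subr_eq0; apply/eqP.
rewrite (big_pred1 [set i]) => [|H]; first by rewrite holder_pmfE// cards1.
rewrite -leqNgt; apply/andP/eqP => [[iH H1]|->]; last by rewrite inE eqxx cards1.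
by apply/esym/eqP; rewrite eqEcard finset.sub1set iH cards1.
Qed.

(** Inclusion-exclusion gives at most [2 a - 1 + p^2], and [2 a - 1 <= a^2]. The square of [a] is
    what makes the second moment comparable with the squared mean. *)
Lemma holder_prob_unshared2_le i j : i != j ->
  holder_prob p (fun H => unshared i H && unshared j H) <=
  (1 - p + p * (1 - p) ^+ (n - 1)) ^+ 2 + p ^+ 2.
Proof.
move=> ij; set a := 1 - p + _.
suff : holder_prob p (fun H => unshared i H && unshared j H) + 1 <= a + a + p ^+ 2.
  by have := sqr_ge0 (a - 1); nra.
have ai : holder_prob p (unshared i) = a := holder_prob_unshared i.
have aj : holder_prob p (unshared j) = a := holder_prob_unshared j.
rewrite -{1}ai -aj -(holder_prob_mem2 ij).
rewrite -(holder_prob_true n p) !holder_prob_mkcond -!big_split/=.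
apply: ler_sum => H _; have := holder_pmf_ge0 p01 H; set w := holder_pmf p H.
rewrite /unshared; case: (i \in H); case: (j \in H); case: (1 < #|H|)%N => /=; lra.
Qed.

Lemma holder_prob_unshared2_ge i j :
  1 - 2 * p <= holder_prob p (fun H => unshared i H && unshared j H).
Proof.
suff : 1 <= holder_prob p (fun H => unshared i H && unshared j H) + p + p by lra.
rewrite -{3}(holder_prob_mem i) -{2}(holder_prob_mem j) -(holder_prob_true n p).
rewrite !holder_prob_mkcond -!big_split/=.
apply: ler_sum => H _; have := holder_pmf_ge0 p01 H; set w := holder_pmf p H.
rewrite /unshared; case: (i \in H); case: (j \in H); case: (1 < #|H|)%N => /=; lra.
Qed.

Lemma holder_prob_paired2_le i j : i != j ->
  holder_prob p (fun H => paired i H && paired j H) <= p ^+ 2 * (1 - p) ^+ (n - 2).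
Proof.
move=> ij; rewrite -(holder_pmf_pair p ij).
rewrite -[leRHS](big_pred1_eq +%R [set i; j]); apply: le_holder_prob => // H /andP[/andP[iH H2] /andP[jH _]]/=.
rewrite eq_sym eqEcard cards2 ij (eqP H2) leqnn andbT.
by apply/fintype.subsetP => x; rewrite !inE => /orP[]/eqP->.
Qed.

Let beta := p ^+ 2 * (1 - p) ^+ (n - 2).
Let gamma := (n%:R - 1) * beta.
Let a := 1 - p + p * (1 - p) ^+ (n - 1).

(** A disjoint union over the witnesses [A]; for each of them the objects are independent, with
    factor [gamma] on [A] and [a] off it. *)
Lemma Gb_event_prob_has_links l i :
  Gb_event_prob (P := P) p (has_links l i) = 'C(P, l)%:R * (gamma ^+ l * a ^+ (P - l)).
Proof.
transitivity (\sum_(A : {set 'I_P} | #|A| == l) Gb_event_prob p (links_exactly A i)).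
  rewrite /Gb_event_prob big_mkcond/=.
  under [RHS]eq_bigr do rewrite big_mkcond/=.
  rewrite exchange_big/=; apply: eq_bigr => S _; case: ifPn.
    move=> /existsP[A /andP[Al SA]]; rewrite (bigD1 A)//= SA big1 ?addr0// => B.
    move=> /andP[_ BA]; case: ifPn => // SB.
    by rewrite (links_exactly_inj SB SA) eqxx in BA.
  rewrite negb_exists => /forallP noA; rewrite big1// => A Al.
  by have := noA A; rewrite Al/= => /negbTE->.
rewrite (eq_bigr (fun=> gamma ^+ l * a ^+ (P - l))).
  rewrite (eq_bigl (fun A : {set 'I_P} => A \in [set A : {set 'I_P} | #|A| == l])).
    by rewrite sumr_const card_draws card_ord mulr_natl.
  by move=> A; rewrite inE.
move=> A /eqP Al; rewrite /links_exactly Gb_event_prob_forall.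
rewrite -[in RHS]Al -[X in (X - _)%N]card_ord -prod_if_mem; apply: eq_bigr => o _.
rewrite /link_test; case: ifP => _; [exact: holder_prob_paired|exact: holder_prob_unshared].
Qed.

(* For witnesses [A] of [i] and [B] of [j], the factor of an object is [beta] on
   [A :&: B], at most [gamma] on the rest of [A :|: B], and [r] elsewhere. *)
Lemma Gb_event_prob_has_links2 l i j (c r0 r1 : R) : i != j -> 0 < r0 -> 0 < gamma ->
  r0 <= holder_prob p (fun H => unshared i H && unshared j H) <= r1 -> 0 <= c ->
  (forall A, #|A| = l ->
     \sum_(B : {set 'I_P} | #|B| == l) (beta / gamma ^+ 2) ^+ #|A :&: B| <= 'C(P, l)%:R * c) ->
  Gb_event_prob (P := P) p (fun S => has_links l i S && has_links l j S) <=
  'C(P, l)%:R ^+ 2 * gamma ^+ (2 * l) * (r1 ^+ P / r0 ^+ (2 * l) * c).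
Proof.
move=> ij r00 g0; set r := holder_prob p _ => /andP[r0r rr1] c0 hc.
have r_gt0 : 0 < r by apply: lt_le_trans r0r.
have r_le1 : r <= 1 by exact: holder_prob_le1.
apply: (@le_trans _ _ (\sum_(A : {set 'I_P} | #|A| == l) \sum_(B : {set 'I_P} | #|B| == l)
    Gb_event_prob p (fun S => links_exactly A i S && links_exactly B j S))).
  rewrite /Gb_event_prob.
  under [leRHS]eq_bigr do under eq_bigr do rewrite big_mkcond/=.
  under [leRHS]eq_bigr do rewrite exchange_big/=.
  rewrite exchange_big/= big_mkcond/=; apply: ler_sum => S _.
  have pmf0 := object_sets_pmf_ge0 S p01.
  have S0 A B : 0 <= if links_exactly A i S && links_exactly B j S
      then object_sets_pmf p S else 0 by case: ifP.
  case: ifPn => [/andP[]|_]; last by do 2 apply: sumr_ge0 => ? _.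
  move=> /existsP[A /andP[Al SA]] /existsP[B /andP[Bl SB]].
  rewrite (bigD1 A)//= (bigD1 B)//= SA SB/= -addrA lerDl addr_ge0//.
    by apply: sumr_ge0 => ? _; case: ifP.
  by do 2 apply: sumr_ge0 => ? _.
pose w := beta / gamma ^+ 2.
have gw : gamma ^+ 2 * w = beta by rewrite /w mulrC divfK// expf_eq0/= gt_eqF.
have b0 : 0 <= beta by rewrite mulr_ge0 ?exprn_ge0.
have w0 : 0 <= w by rewrite divr_ge0// exprn_ge0// ltW.
apply: (@le_trans _ _ (\sum_(A : {set 'I_P} | #|A| == l) \sum_(B : {set 'I_P} | #|B| == l)
    (r ^+ P * (gamma / r) ^+ (2 * l)) * w ^+ #|A :&: B|)).
  apply: ler_sum => A /eqP Al; apply: ler_sum => B /eqP Bl.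
  rewrite (_ : Gb_event_prob _ _ = \prod_(o < P)
      holder_prob p (fun H => link_test A i o H && link_test B j o H)); last first.
    rewrite -Gb_event_prob_forall; apply: eq_bigl => S; apply/andP/forallP.
      by move=> [/forallP SA /forallP SB] o; rewrite SA SB.
    by move=> SAB; split; apply/forallP => o; have /andP[] := SAB o.
  (* In this form the product depends only on the sizes of [A], [B] and [A :&: B]. On the
     intersection the factor is [beta / r], which is at least [beta] because [r <= 1]. *)
  apply: (@le_trans _ _ (\prod_(o < P) (r * ((if o \in A then gamma / r else 1) *
      (if o \in B then gamma / r else 1)) * (if o \in A :&: B then w else 1)))).
    apply: ler_prod => o _; rewrite holder_prob_ge0//= inE /link_test.
    case: ifP => oA; case: ifP => oB /=; rewrite ?mulr1 ?mul1r.
    + apply: le_trans (holder_prob_paired2_le ij) _; rewrite -/beta -gw.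
      apply: ler_wpM2r => //; rewrite -[leLHS]mulr1.
      rewrite [leRHS](_ : _ = gamma ^+ 2 * r^-1); last by field; rewrite gt_eqF.
      by apply: ler_wpM2l; [rewrite exprn_ge0// ltW|rewrite invf_ge1].
    + rewrite mulrC divfK ?gt_eqF// /gamma /beta -(holder_prob_paired i).
      by apply: le_holder_prob => // H /andP[].
    + rewrite mulrC divfK ?gt_eqF// /gamma /beta -(holder_prob_paired j).
      by apply: le_holder_prob => // H /andP[].
    + by [].
  rewrite !big_split/= prodr_const card_ord !prod_if_mem !expr1n !mulr1 Al Bl.
  by rewrite -exprD addnn mul2n.
under eq_bigr do rewrite -big_distrr/=.
rewrite -big_distrr/=.
apply: (@le_trans _ _ (r ^+ P * (gamma / r) ^+ (2 * l) * ('C(P, l)%:R ^+ 2 * c))).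
  apply: ler_wpM2l; first by rewrite mulr_ge0 ?exprn_ge0 ?divr_ge0 ?ltW.
  apply: (@le_trans _ _ (\sum_(A : {set 'I_P} | #|A| == l) 'C(P, l)%:R * c)).
    by apply: ler_sum => A /eqP Al; exact: hc.
  rewrite (eq_bigl (fun A : {set 'I_P} => A \in [set A : {set 'I_P} | #|A| == l])).
    by rewrite sumr_const card_draws card_ord -[leLHS]mulr_natl mulrA -expr2.
  by move=> A; rewrite inE.
rewrite expr_div_n mulrCA mulrC [leRHS]mulrC !mulrA.
rewrite [leLHS](_ : _ = (r ^+ P / r ^+ (2 * l)) * ('C(P, l)%:R ^+ 2 * gamma ^+ (2 * l) * c)); last by ring.
rewrite [leRHS](_ : _ = (r1 ^+ P / r0 ^+ (2 * l)) * ('C(P, l)%:R ^+ 2 * gamma ^+ (2 * l) * c)); last by ring.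
apply: ler_wpM2r; first by rewrite !mulr_ge0// ?exprn_ge0// ltW.
apply: ler_pM; rewrite ?invr_ge0 ?exprn_ge0 ?(ltW r_gt0)//.
  by rewrite lerXn2r// nnegrE ?(ltW r_gt0)//; apply: le_trans rr1; exact: ltW.
by rewrite lef_pV2 ?posrE ?exprn_gt0// lerXn2r// nnegrE ltW.
Qed.

End LinkLaw.

(** * Overlaps of two witness sets *)

(** Lowering the lower index from [j + 1] to [j < l] multiplies the coefficient by
    [(j + 1) / (P - j)], at most [l / (P - l + 1)]. *)
Lemma bin_sub_le (R : realType) (P l m : nat) : (l <= P)%N -> (m <= l)%N ->
  'C(P, l - m)%:R <= 'C(P, l)%:R * (l%:R / (P - l).+1%:R) ^+ m :> R.
Proof.
move=> lP; elim: m => [|m IH] ml; first by rewrite subn0 mulr1.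
have z0 : 0 < (P - l).+1%:R :> R by rewrite ltr0n.
rewrite exprSr mulrA; apply: le_trans (ler_wpM2r _ (IH (ltnW ml))); last first.
  by rewrite divr_ge0.
rewrite mulrA ler_pdivlMr// -!natrM ler_nat.
have := mul_bin_left P (l - m.+1); rewrite (_ : (l - m.+1).+1 = (l - m)%N); last by lia.
move=> e; have : ((P - l).+1 <= P - (l - m.+1))%N by lia.
move=> /(leq_mul (leqnn 'C(P, l - m.+1))) => /leq_trans; apply.
by rewrite mulnC -e mulnC leq_mul2l leq_subr orbT.
Qed.

Lemma sum_exp_card_subset (R : realType) (T : finType) (A : {set T}) (u : R) :
  \sum_(C : {set T} | C \subset A) u ^+ #|C| = (1 + u) ^+ #|A|.
Proof.
transitivity (\prod_(o : T) ((if o \in A then u else 0) + 1)).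
  rewrite (@bigA_distr R 0 1 *%R +%R)/= big_mkcond/=; apply: eq_bigr => C _.
  case: ifPn => [/fintype.subsetP CA|/fintype.subsetPn[ o oC oA]]; last first.
    by rewrite (bigD1 o)//= oC (negbTE oA) mul0r.
  transitivity (\prod_(o : T) (if o \in C then u else 1)).
    by rewrite prod_if_mem expr1n mulr1.
  by apply: eq_bigr => o _; case: ifP => // /CA ->.
rewrite -[RHS]mulr1 -[X in _ = _ * X](expr1n R (#|T| - #|A|)) -prod_if_mem; apply: eq_bigr => o _.
by case: ifP; rewrite ?add0r// addrC.
Qed.

(** The sets [B] are grouped by [C = A :&: B]. Given [C], [B] is determined by [B :\: C], of size
    [l - #|C|], so [bin_sub_le] bounds their number, and the sum over [C] is a binomial
    expansion. *)
Lemma sum_exp_cardI_le (R : realType) (P l : nat) (w : R) (A : {set 'I_P}) :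
  0 <= w -> (l <= P)%N -> #|A| = l ->
  \sum_(B : {set 'I_P} | #|B| == l) w ^+ #|A :&: B| <=
  'C(P, l)%:R * (1 + w * (l%:R / (P - l).+1%:R)) ^+ l.
Proof.
move=> w0 lP Al.
rewrite (partition_big (fun B : {set 'I_P} => A :&: B) (fun C => C \subset A))/=; last first.
  by move=> B _; exact: finset.subsetIl.
rewrite -[X in _ <= _ * (_ ^+ X)]Al -sum_exp_card_subset big_distrr/=; apply: ler_sum => C CA.
have Cl : (#|C| <= l)%N by rewrite -Al subset_leq_card.
rewrite (eq_bigr (fun=> w ^+ #|C|)); last by move=> B /andP[_ /eqP->].
rewrite exprMn mulrCA -[leLHS]mulr1.
rewrite (eq_bigl (fun B : {set 'I_P} => B \in [set B : {set 'I_P} | (#|B| == l) && (A :&: B == C)])).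
  rewrite sumr_const -[X in X * _]mulr_natr mulr1.
  apply: ler_wpM2l; first exact: exprn_ge0.
  apply: le_trans (bin_sub_le R lP Cl); rewrite ler_nat.
  rewrite -[X in 'C(X, _)](card_ord P) -card_draws.
  rewrite -(card_in_imset (f := fun B : {set 'I_P} => B :\: C)).
    apply: subset_leq_card; apply/fintype.subsetP => D /imsetP[B].
    rewrite !inE => /andP[/eqP Bl /eqP BC] ->; rewrite cardsD Bl.
    by rewrite (finset.setIidPr _)// -BC finset.subsetIr.
  move=> B B'; rewrite !inE => /andP[_ /eqP BC] /andP[_ /eqP BC'] e.
  have h D : A :&: D = C -> D = (D :\: C) :|: C.
    by move=> <-; apply/setP => x; rewrite !inE; case: (x \in A); case: (x \in D).
  by rewrite (h B)// (h B')// e.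
by move=> B; rewrite inE.
Qed.

(** * Second moment method *)

(** Chebyshev's inequality for the number [X] of events that occur, of mean [m = n m1]: if none
    occurs then [(X - m)^2 = m^2], and the mean of [X^2] is at most [m + n^2 m2], the diagonal
    giving [m]. *)
Lemma second_moment_le (R : realType) (n P : nat) (p m1 m2 : R)
    (E : 'I_n -> pred {ffun 'I_n -> {set 'I_P}}) : 0 <= p <= 1 ->
  (forall i, Gb_event_prob p (E i) = m1) ->
  (forall i j, i != j -> Gb_event_prob p (fun S => E i S && E j S) <= m2) ->
  0 <= m2 ->
  Gb_event_prob p (fun S => [forall i, ~~ E i S]) * (n%:R * m1) ^+ 2 <=
  n%:R * m1 + n%:R ^+ 2 * m2 - (n%:R * m1) ^+ 2.
Proof.
move=> p01 hm1 hm2 m20.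
pose X S : R := \sum_i (E i S)%:R; pose m := n%:R * m1.
have mulb S (b : bool) : object_sets_pmf p S * b%:R = if b then object_sets_pmf p S else 0.
  by case: b; rewrite ?mulr1 ?mulr0.
have EX : \sum_S object_sets_pmf p S * X S = m.
  under eq_bigr do rewrite /X big_distrr/=.
  rewrite exchange_big/= (eq_bigr (fun=> m1)).
    by rewrite sumr_const card_ord -[LHS]mulr_natl.
  move=> i _; under eq_bigr do rewrite mulb.
  by rewrite -big_mkcond -(hm1 i).
have EX2 : \sum_S object_sets_pmf p S * X S ^+ 2 <= m + n%:R ^+ 2 * m2.
  rewrite (_ : \sum_S _ = \sum_i \sum_j Gb_event_prob p (fun S => E i S && E j S)); last first.
    transitivity (\sum_S \sum_i \sum_j object_sets_pmf p S * (E i S && E j S)%:R).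
      apply: eq_bigr => S _; rewrite expr2 /X big_distrl/= big_distrr/=.
      apply: eq_bigr => i _; rewrite !big_distrr/=; apply: eq_bigr => j _.
      by rewrite -natrM mulnb.
    rewrite exchange_big/=; apply: eq_bigr => i _.
    rewrite exchange_big/=; apply: eq_bigr => j _.
    by under eq_bigr do rewrite mulb; rewrite -big_mkcond.
  apply: (@le_trans _ _ (\sum_(i < n) (m1 + n%:R * m2))).
    apply: ler_sum => i _; rewrite (bigD1 i)//=; apply: lerD.
      by rewrite -(hm1 i); apply: le_Gb_event_prob => // S /andP[].
    apply: (@le_trans _ _ (\sum_(j < n | j != i) m2)).
      by apply: ler_sum => j ji; apply: hm2; rewrite eq_sym.
    apply: (@le_trans _ _ (\sum_(j < n) m2)).
      by rewrite big_mkcond/=; apply: ler_sum => j _; case: ifP.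
    by rewrite sumr_const card_ord -[leLHS]mulr_natl.
  by rewrite sumr_const card_ord -[leLHS]mulr_natl /m expr2; lra.
have total : \sum_(S : {ffun 'I_n -> {set 'I_P}}) object_sets_pmf p S = 1.
  exact: Gb_prob_total.
rewrite -/m.
apply: (@le_trans _ _ (\sum_S object_sets_pmf p S * (X S - m) ^+ 2)).
  rewrite /Gb_event_prob big_distrl/= big_mkcond/=; apply: ler_sum => S _.
  have pmf0 := object_sets_pmf_ge0 S p01.
  case: ifPn => [/forallP noE|_]; last by rewrite mulr_ge0// sqr_ge0.
  by rewrite /X big1 ?sub0r ?sqrrN// => i _; rewrite (negbTE (noE i)).
rewrite (_ : \sum_S _ = \sum_S object_sets_pmf p S * X S ^+ 2 -
    2 * m * (\sum_S object_sets_pmf p S * X S) +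
    m ^+ 2 * (\sum_(S : {ffun 'I_n -> {set 'I_P}}) object_sets_pmf p S)).
  by rewrite EX total; move: EX2; set Y := \sum_S _; lra.
rewrite !big_distrr/= -sumrN -!big_split/=; apply: eq_bigr => S _; ring.
Qed.

Lemma Gb_prob_k_robust_no_links (R : realType) (n P l : nat) (p : R) :
  0 <= p <= 1 -> (1 < n)%N ->
  Gb_prob P p (fun adj : rel 'I_n => k_robust adj l.+1) <=
  Gb_event_prob (P := P) p (fun S => [forall i : 'I_n, ~~ has_links l i S]).
Proof.
move=> p01 n1; apply: le_Gb_event_prob => // S robS; apply/forallP => i.
apply/negP => /has_links_degree; apply/negP; rewrite -ltnNge.
apply: k_robust_degree robS; rewrite ?card_ord//.
- by move=> x y; rewrite /intersection_adj eq_sym finset.setIC.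
- by move=> x; rewrite /intersection_adj eqxx.
Qed.

(** * Finite bound below the threshold *)

Lemma expn_le_ffact (m l : nat) : ((m - l) ^ l <= m ^_ l)%N.
Proof.
elim: l m => [|l IH] m; first by rewrite ffactn0.
case: m => [|m]; first by rewrite sub0n exp0n.
rewrite subSS ffactSS expnS; apply: leq_mul (IH m).
by apply: leq_trans (leq_subr _ _) _.
Qed.

(** Every factor of the falling factorial is at least [P - l], hence at least [P / 2]. *)
Lemma bin_ge_half_pow (R : realType) (P l : nat) : (2 * l <= P)%N ->
  (P%:R / 2) ^+ l / l`!%:R <= 'C(P, l)%:R :> R.
Proof.
move=> lP; rewrite ler_pdivrMr ?ltr0n ?fact_gt0// -natrM bin_ffact.
apply: (@le_trans _ _ ((P - l)%:R ^+ l)); last by rewrite -natrX ler_nat expn_le_ffact.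
have : l%:R * 2 <= P%:R :> R by rewrite -natrM ler_nat mulnC.
move=> h; apply: lerXn2r; rewrite ?nnegrE ?divr_ge0//.
by rewrite natrB; [lra | lia].
Qed.

(** Taking inverses, this is [1 + z <= exp z] at [z = y / (1 - y)]. *)
Lemma expRN_div_onesub_le (R : realType) (y : R) : y < 1 -> expR (- (y / (1 - y))) <= 1 - y.
Proof.
move=> y1; have y0 : 0 < 1 - y by rewrite subr_gt0.
rewrite expRN invf_ple ?posrE ?expR_gt0//; apply: le_trans (expR_ge1Dx _).
by rewrite [leRHS](_ : _ = (1 - y)^-1)//; field; rewrite gt_eqF.
Qed.

Lemma sqrD_le_mul (R : realType) (a q v : R) :
  1 / 2 <= a -> 0 <= q -> 1 + 4 * q <= v -> a ^+ 2 + q <= a ^+ 2 * v.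
Proof.
move=> a2 q0 qv; have aa : 1 / 4 <= a ^+ 2 by nra.
apply: (@le_trans _ _ (a ^+ 2 * (1 + 4 * q))); first by move: (a ^+ 2) aa => u aa; nra.
by rewrite ler_wpM2l// sqr_ge0.
Qed.

Lemma onesub2_mul_ge1 (R : realType) (p : R) :
  0 <= p -> p <= 1 / 4 -> 1 <= (1 + 4 * p) * (1 - 2 * p).
Proof. by move=> h1 h2; nra. Qed.

Section SubcriticalBound.
Variables (R : realType) (n P l : nat) (p alpha N L b : R).
Hypothesis NE : N = n%:R.
Hypothesis LE : L = ln N.
Hypothesis b_def : b = p ^+ 2 * P%:R.
Hypothesis n2 : (1 < n)%N.
Hypothesis p01 : 0 <= p <= 1.
Hypothesis L8 : 8 <= L.
Hypothesis bE : N * b = L + l%:R * ln L + alpha.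
Hypothesis b_ge : 3 / 4 * L <= N * b.
Hypothesis b_le : N * b <= 5 / 4 * L.
Hypothesis npL : N * p * L <= 1.
Hypothesis lP : (2 * l <= P)%N.

Let N2 : 2 <= N. Proof. by rewrite NE ler_nat. Qed.
Let beta := p ^+ 2 * (1 - p) ^+ (n - 2).
Let gamma := (n%:R - 1) * beta.
Let a := 1 - p + p * (1 - p) ^+ (n - 1).
Let m1 := 'C(P, l)%:R * (gamma ^+ l * a ^+ (P - l)).

Let p_gt0 : 0 < p.
Proof.
have /andP[p0 _] := p01; rewrite lt_neqAle p0 andbT; apply/eqP => p0'.
move: (b_ge) (L8); rewrite b_def -p0' expr0n mul0r mulr0; lra.
Qed.

Let np8 : 8 * (N * p) <= 1.
Proof.
move: (npL) (L8) (N2) (p_gt0) => h1 h2 h3 h4.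
have : 0 <= N * p by rewrite mulr_ge0 ?ltW//; lra.
nra.
Qed.

Let p_le16 : p <= 1 / 16. Proof. by move: (np8) (N2) (p_gt0) => h1 h2 h3; nra. Qed.

Let a_le1 : a <= 1.
Proof.
have : (1 - p) ^+ (n - 1) <= 1.
  by have /andP[h0 h1] := p01; apply: exprn_ile1; lra.
by move: (p_gt0) => h1 h2; rewrite /a; nra.
Qed.

Let a_ge : 1 - N * p ^+ 2 <= a.
Proof.
have := Bernoulli_ineq (n - 1) p01.
have : (n - 1)%:R <= N by rewrite NE ler_nat leq_subr.
move: (p_gt0); rewrite /a; set c := _ ^+ (n - 1); set d := _%:R => h1 h2 h3; nra.
Qed.

Let a_ge2 : 1 / 2 <= a.
Proof.
move: (a_ge) (np8) (p_le16) (p_gt0) (N2) => h1 h2 h3 h4 h5.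
have : 0 <= N * p by rewrite mulr_ge0 ?ltW//; lra.
nra.
Qed.

Let beta_ge : p ^+ 2 / 2 <= beta.
Proof.
rewrite /beta; apply: ler_wpM2l; first by rewrite exprn_ge0// ltW.
apply: le_trans (Bernoulli_ineq (n - 2) p01).
have : (n - 2)%:R <= N by rewrite NE ler_nat leq_subr.
move: (p_gt0) (np8); set d := _%:R => h1 h2 h3; nra.
Qed.

Let beta_gt0 : 0 < beta.
Proof. by apply: lt_le_trans beta_ge; rewrite divr_gt0// exprn_gt0. Qed.

Let gamma_ge : N * p ^+ 2 / 4 <= gamma.
Proof.
rewrite /gamma -NE; move: (beta_ge) (beta_gt0) (N2) => h1 h2 h3.
apply: (@le_trans _ _ (N / 2 * (p ^+ 2 / 2))); first by lra.
by apply: ler_pM => //; rewrite ?divr_ge0 ?sqr_ge0//; lra.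
Qed.

Let gamma_gt0 : 0 < gamma.
Proof.
apply: lt_le_trans gamma_ge; move: (N2) (exprn_gt0 2 p_gt0) => h1 h2.
by rewrite divr_gt0 ?mulr_gt0//; lra.
Qed.

(** The [l] links give at least [(N b / 8)^l / l!], and [N b >= L / 2] explains the 16. The
    remaining objects give at least [exp (- (N b + 1))], and the formula for [N b] makes
    [N L^l exp (- N b)] equal to [exp (- alpha)]. *)
Lemma mean_low_degree_ge : expR (- alpha - 1) / (16 ^+ l * l`!%:R) <= N * m1.
Proof.
move: (N2) (b_ge) (b_le) (npL) (L8) (p_gt0) (np8) (p_le16) => hN2 hbg hbl hnpL hL hp hnp hp16.
have Np0 : 0 <= N * p by rewrite mulr_ge0 ?ltW//; lra.
have P0 : 0 <= P%:R :> R by [].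
have l0 : 0 < l`!%:R :> R by rewrite ltr0n fact_gt0.
have links : (L / 16) ^+ l / l`!%:R <= 'C(P, l)%:R * gamma ^+ l.
  apply: (@le_trans _ _ (((P%:R / 2) ^+ l / l`!%:R) * (N * p ^+ 2 / 4) ^+ l)); last first.
    apply: ler_pM.
    - by rewrite divr_ge0 ?exprn_ge0 ?divr_ge0// ltW.
    - by rewrite exprn_ge0// divr_ge0// mulr_ge0 ?exprn_ge0//; lra.
    - exact: bin_ge_half_pow.
    - by rewrite lerXn2r// nnegrE ?(ltW gamma_gt0)// divr_ge0// mulr_ge0 ?exprn_ge0//; lra.
  rewrite mulrAC -exprMn; apply: ler_wpM2r; first by rewrite invr_ge0 ltW.
  have -> : P%:R / 2 * (N * p ^+ 2 / 4) = N * b / 8 by rewrite b_def; lra.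
  by rewrite lerXn2r// ?nnegrE; lra.
have aP : expR (- (N * b + 1)) <= a ^+ (P - l).
  apply: (@le_trans _ _ (a ^+ P)); last first.
    apply: ler_wiXn2l; rewrite ?leq_subr//; move: (a_ge2); lra.
  set y := N * p ^+ 2.
  have y0 : 0 <= y by rewrite mulr_ge0 ?exprn_ge0 ?ltW//; lra.
  have y1 : y <= 1 / 2 by rewrite /y; nra.
  apply: (@le_trans _ _ (expR (- (y / (1 - y))) ^+ P)); last first.
    rewrite lerXn2r// ?nnegrE ?expR_ge0//; first by move: (a_ge2); lra.
    by apply: le_trans a_ge; apply: expRN_div_onesub_le; lra.
  rewrite -expRM_natl ler_expR mulrN lerN2.
  rewrite mulrA ler_pdivrMr; last by lra.
  have -> : P%:R * y = N * b by rewrite b_def /y; ring.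
  (* With the denominator cleared, the goal amounts to [N b y + y <= 1]. *)
  have : N * b * y <= 1 / 4; last by move: (N * b) hbg hbl => d *; nra.
  rewrite (_ : N * b * y = N * b * (N * p) * p); last by rewrite /y; ring.
  have h : N * b * (N * p) <= 5 / 4.
    by apply: le_trans (ler_wpM2r Np0 hbl) _; lra.
  have : 0 <= N * b * (N * p) by rewrite mulr_ge0//; lra.
  nra.
have L0 : 0 < L by lra.
have N0 : 0 < N by lra.
rewrite (_ : expR (- alpha - 1) = N * (L ^+ l * expR (- (N * b + 1)))); last first.
  have NL : N = expR L by rewrite LE lnK ?posrE.
  have Ll : L ^+ l = expR (l%:R * ln L) by rewrite expRM_natl lnK ?posrE.
  by rewrite [X in _ = X * _]NL Ll -!expRD bE; congr expR; ring.
rewrite /m1 -mulrA; apply: ler_wpM2l; first lra.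
rewrite [leLHS](_ : _ = (L / 16) ^+ l / l`!%:R * expR (- (N * b + 1))); last first.
  by rewrite expr_div_n; field; rewrite ?gt_eqF// exprn_gt0.
rewrite mulrA; apply: ler_pM; rewrite ?expR_ge0//.
by rewrite divr_ge0 ?exprn_ge0 ?divr_ge0// ltW.
Qed.

(** Near independence of two nodes. The excess over [m1 ^+ 2] comes from unlinked objects
    ([exp (4 b)]), from normalising linked ones ([exp (8 l p)]) and from overlapping witnesses
    ([exp (16 l^2 / N)]); each exponent is small by the window conditions. *)
Lemma joint_low_degree_le :
  'C(P, l)%:R ^+ 2 * gamma ^+ (2 * l) *
    ((a ^+ 2 + p ^+ 2) ^+ P / (1 - 2 * p) ^+ (2 * l) *
     (1 + beta / gamma ^+ 2 * (l%:R / (P - l).+1%:R)) ^+ l) <=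
  m1 ^+ 2 * expR ((5 * L + 8 * l%:R + 16 * l%:R ^+ 2) / N).
Proof.
move: (N2) (b_ge) (b_le) (npL) (L8) (p_gt0) (np8) (p_le16) (a_ge2) (a_le1) (beta_gt0) (gamma_gt0)
  => hN2 hbg hbl hnpL hL hp hnp hp16 ha ha1 hbeta hgamma.
have N0 : 0 < N by lra.
have P0 : 0 <= P%:R :> R by [].
have l0 : 0 <= l%:R :> R by [].
have e1 : (a ^+ 2 + p ^+ 2) ^+ P <= (a ^+ (P - l)) ^+ 2 * expR (4 * b).
  apply: (@le_trans _ _ ((a ^+ 2 * expR (4 * p ^+ 2)) ^+ P)).
    apply: lerXn2r; rewrite ?nnegrE.
    - by rewrite addr_ge0 ?sqr_ge0.
    - by rewrite mulr_ge0 ?sqr_ge0 ?expR_ge0.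
    by apply: sqrD_le_mul; rewrite ?sqr_ge0 ?expR_ge1Dx.
  rewrite exprMn -expRM_natl (_ : P%:R * _ = 4 * b); last by rewrite b_def; ring.
  apply: ler_wpM2r; first exact: expR_ge0.
  rewrite -!exprM.
  apply: ler_wiXn2l.
  - by apply: le_trans ha; rewrite divr_ge0.
  - exact: ha1.
  - by rewrite mulnC leq_mul2l leq_subr.
have e2 : ((1 - 2 * p) ^+ (2 * l))^-1 <= expR (8 * l%:R * p).
  rewrite (_ : 8 * l%:R * p = (2 * l)%:R * (4 * p)); last by rewrite natrM; ring.
  rewrite expRM_natl -exprVn lerXn2r ?nnegrE ?invr_ge0 ?expR_ge0//; first by lra.
  apply: le_trans (expR_ge1Dx _); rewrite -[leLHS]mul1r ler_pdivrMr; last by lra.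
  by apply: onesub2_mul_ge1; rewrite ?ltW//; lra.
have e3 : (1 + beta / gamma ^+ 2 * (l%:R / (P - l).+1%:R)) ^+ l <= expR (16 * l%:R ^+ 2 / N).
  rewrite (_ : 16 * l%:R ^+ 2 / N = l%:R * (16 * l%:R / N)); last by ring.
  have w0 : 0 <= beta / gamma ^+ 2 * (l%:R / (P - l).+1%:R).
    by apply: mulr_ge0; rewrite divr_ge0 ?sqr_ge0// ltW.
  rewrite expRM_natl lerXn2r ?nnegrE ?expR_ge0 ?addr_ge0//.
  apply: le_trans (expR_ge1Dx _); rewrite lerD2l.
  have -> : beta / gamma ^+ 2 = ((N - 1) * gamma)^-1.
    by rewrite /gamma -NE; field; rewrite !gt_eqF//; lra.
  rewrite mulrC [leRHS](_ : _ = l%:R * (16 / N)); last by ring.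
  rewrite -[leLHS]mulrA.
  apply: ler_wpM2l => //.
  have half : P%:R / 2 <= (P - l).+1%:R :> R.
    have : l%:R * 2 <= P%:R :> R by rewrite -natrM ler_nat mulnC.
    by move=> h; rewrite -[leRHS]natr1 natrB; [lra|apply: leq_trans lP; rewrite leq_pmull].
  (* The 16 is [2 * 2 * 4], from [P - l + 1 >= P / 2], [N - 1 >= N / 2] and [gamma_ge]; what remains
     is [N * (N b)], with [N b >= 1]. *)
  have XN : N / 16 <= (P - l).+1%:R * ((N - 1) * gamma).
    apply: (@le_trans _ _ (P%:R / 2 * (N / 2 * (N * p ^+ 2 / 4)))).
      rewrite (_ : P%:R / 2 * _ = N * (N * b) / 16); last by rewrite b_def; lra.
      suff : N <= N * (N * b) by lra.
      by rewrite ler_peMr//; lra.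
    have Np2 : 0 <= N * p ^+ 2 / 4 by rewrite divr_ge0// mulr_ge0 ?sqr_ge0// ltW.
    have N20 : 0 <= N / 2 by lra.
    have N21 : N / 2 <= N - 1 by lra.
    have P20 : 0 <= P%:R / 2 :> R by rewrite divr_ge0.
    exact: ler_pM P20 (mulr_ge0 N20 Np2) half (ler_pM N20 Np2 N21 gamma_ge).
  have N16 : 0 < N / 16 by lra.
  by rewrite -invfM -[leRHS]invf_div lef_pV2 ?posrE//; apply: lt_le_trans XN.
have r0 : 0 < 1 - 2 * p by lra.
have w0 : 0 <= (1 + beta / gamma ^+ 2 * (l%:R / (P - l).+1%:R)) ^+ l.
  by rewrite exprn_ge0// addr_ge0//; apply: mulr_ge0; rewrite divr_ge0 ?sqr_ge0// ltW.
rewrite /m1 (_ : _ ^+ 2 * expR _ = 'C(P, l)%:R ^+ 2 * gamma ^+ (2 * l) *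
   ((a ^+ (P - l)) ^+ 2 * expR ((5 * L + 8 * l%:R + 16 * l%:R ^+ 2) / N))); last first.
  by rewrite mulnC exprM; ring.
apply: ler_wpM2l; first by rewrite mulr_ge0 ?exprn_ge0// ltW.
apply: (@le_trans _ _ ((a ^+ (P - l)) ^+ 2 * expR (4 * b) * expR (8 * l%:R * p) *
    expR (16 * l%:R ^+ 2 / N))).
  have A0 : 0 <= (a ^+ 2 + p ^+ 2) ^+ P by rewrite exprn_ge0// addr_ge0 ?sqr_ge0.
  have R0 : 0 <= ((1 - 2 * p) ^+ (2 * l))^-1 by rewrite invr_ge0 exprn_ge0// ltW.
  exact: ler_pM (mulr_ge0 A0 R0) w0 (ler_pM A0 R0 e1 e2) e3.
rewrite -[leLHS]mulrA -[leLHS]mulrA; apply: ler_wpM2l; first exact: sqr_ge0.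
rewrite -!expRD ler_expR ler_pdivlMr//.
rewrite (_ : _ * N = 4 * (N * b) + 8 * (l%:R * (N * p)) + 16 * l%:R ^+ 2); last first.
  by field; rewrite gt_eqF.
have : l%:R * (N * p) <= l%:R by rewrite ler_piMr//; lra.
lra.
Qed.

Lemma Gb_prob_k_robust_le :
  Gb_prob P p (fun adj : rel 'I_n => k_robust adj l.+1) <=
  16 ^+ l * l`!%:R * expR (alpha + 1) +
  (expR ((5 * L + 8 * l%:R + 16 * l%:R ^+ 2) / N) - 1).
Proof.
move: (N2) (p_gt0) (np8) (p_le16) (beta_gt0) (gamma_gt0)
  => hN2 hp hnp hp16 hbeta hgamma.
set K := expR (_ / N).
apply: le_trans (Gb_prob_k_robust_no_links _ _ p01 n2) _.
set Q := Gb_event_prob _ _.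
have m1_ge := mean_low_degree_ge; have m2_le := joint_low_degree_le; rewrite -/K in m2_le.
have l0 : 0 < 16 ^+ l * l`!%:R :> R by rewrite mulr_gt0 ?exprn_gt0// ltr0n fact_gt0.
have mu0 : 0 < N * m1 by apply: lt_le_trans m1_ge; rewrite divr_gt0 ?expR_gt0.
have : Q * (N * m1) ^+ 2 <= N * m1 + N ^+ 2 * (m1 ^+ 2 * K) - (N * m1) ^+ 2.
  rewrite NE; apply: second_moment_le => //.
  - by move=> i; exact: Gb_event_prob_has_links.
  - move=> i j ij; apply: le_trans m2_le; apply: Gb_event_prob_has_links2 => //.
    + by lra.
    + by rewrite holder_prob_unshared2_ge// holder_prob_unshared2_le.
    + by rewrite exprn_ge0// addr_ge0//; apply: mulr_ge0; rewrite divr_ge0 ?sqr_ge0// ltW.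
    + by move=> A Al; apply: sum_exp_cardI_le => //; [rewrite divr_ge0 ?sqr_ge0// ltW|apply: leq_trans lP; rewrite leq_pmull].
  - by rewrite mulr_ge0 ?sqr_ge0 ?expR_ge0.
(* After division by the squared mean, the failure probability is at most the inverse mean plus the
   relative excess [K - 1] of the joint probability. *)
rewrite (_ : N * m1 + _ - _ = ((N * m1)^-1 + (K - 1)) * (N * m1) ^+ 2); last first.
  by field; rewrite !gt_eqF//; [lra|move: mu0; rewrite pmulr_rgt0//; lra].
rewrite ler_pM2r ?exprn_gt0// => /le_trans; apply; rewrite lerD2r.
have E0 : 0 < expR (- alpha - 1) / (16 ^+ l * l`!%:R) by rewrite divr_gt0 ?expR_gt0.
by move: m1_ge; rewrite -lef_pV2 ?posrE// invf_div -expRN opprD !opprK.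
Qed.

End SubcriticalBound.

Local Open Scope classical_set_scope.

(** * Asymptotics *)

Lemma ln_nat_near_ge (R : realType) (A : R) : \forall n \near \oo, A <= ln (n%:R : R).
Proof.
near=> n; have An : expR A <= n%:R by near: n; exact: nbhs_infty_ger.
by rewrite -[A]expRK ler_ln ?posrE ?expR_gt0//; apply: lt_le_trans An; exact: expR_gt0.
Unshelve. all: by end_near. Qed.

(** The cubic term [x^3 / 6] suffices, since [24 / 6 = 4]. *)
Lemma sqr_le_expR (R : realType) (x : R) : 24 <= x -> 4 * x ^+ 2 <= expR x.
Proof.
move=> x24; apply: le_trans (@expR_ge1Dxn R x 2 _); last by lra.
rewrite (_ : 3`!%:R = 6 :> R)//.
have : 0 <= x ^+ 2 by exact: sqr_ge0.
by rewrite [x ^+ 3]exprSr; move: (x ^+ 2) => u u0; nra.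
Qed.

(** With [M = ln x >= 16 l], the quadratic term gives [x >= M^2 / 2 >= 8 l M]. *)
Lemma mulr_ln_le (R : realType) (l : nat) (x : R) :
  expR (16 * l%:R) <= x -> 0 <= l%:R * ln x <= x / 8.
Proof.
move=> lx; have x0 : 0 < x by apply: lt_le_trans lx; exact: expR_gt0.
have l0 : 0 <= l%:R :> R by [].
have M16 : 16 * l%:R <= ln x.
  by rewrite -[leLHS]expRK ler_ln ?posrE ?expR_gt0.
have M0 : 0 <= ln x by lra.
rewrite mulr_ge0//=; have := @expR_ge1Dxn R (ln x) 1 M0.
rewrite lnK ?posrE// (_ : 2`!%:R = 2 :> R)// => h.
by move: (ln x) h M16 M0 => M h M16 M0; nra.
Qed.

(** Besides [0 <= p <= 1] and the size of [alpha], these are the conditions that the finite bounds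
    impose on a single [n]. *)
Definition in_window (R : realType) (l P : nat) (p alpha : R) (n : nat) :=
  [/\ (1 < n)%N, 8 <= ln (n%:R : R) & 4 * ln (n%:R : R) ^+ 2 <= n%:R] /\
  [/\ n%:R * (p ^+ 2 * P%:R) = ln n%:R + l%:R * ln (ln n%:R) + alpha,
      3 / 4 * ln n%:R <= n%:R * (p ^+ 2 * P%:R),
      n%:R * (p ^+ 2 * P%:R) <= 5 / 4 * ln n%:R,
      n%:R * p * ln n%:R <= 1 & (2 * l <= P)%N].

Section CriticalWindow.
Variables (R : realType) (l : nat) (P : nat -> nat) (p alpha : nat -> R).
Hypothesis hp : forall n, 0 <= p n <= 1.
Hypothesis halpha : forall n, (2 <= n)%N ->
  p n ^+ 2 * (P n)%:R = (ln n%:R + l%:R * ln (ln n%:R) + alpha n) / n%:R.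
Hypothesis hP : (fun n : nat => (P n)%:R : R) \is
  'Omega_\oo (fun n : nat => n%:R * ln n%:R ^+ 5 : R).
Hypothesis halpha_o : (fun n : nat => `|alpha n|) =o_\oo (fun n : nat => ln n%:R : R).

Lemma in_window_near : \forall n \near \oo, in_window l (P n) (p n) (alpha n) n.
Proof.
have := hP; rewrite qualifE => /asboolP[c c0 Pc].
have alphaL : \forall n \near \oo, `| `|alpha n| | <= 8^-1 * `|ln n%:R : R|.
  by move/eqoP: halpha_o; apply; rewrite invr_gt0.
near=> n.
suff H (N L b : R) : N = n%:R -> L = ln N -> b = p n ^+ 2 * (P n)%:R ->
    [/\ (1 < n)%N, 8 <= L & 4 * L ^+ 2 <= N] /\
    [/\ N * b = L + l%:R * ln L + alpha n, 3 / 4 * L <= N * b, N * b <= 5 / 4 * L,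
        N * p n * L <= 1 & (2 * l <= P n)%N].
  exact: H.
move=> NE LE bE.
have n2 : (1 < n)%N by near: n; exact: nbhs_infty_gt.
have L24 : 24 <= L by rewrite LE NE; near: n; exact: ln_nat_near_ge.
have Ll : expR (16 * l%:R) <= L by rewrite LE NE; near: n; exact: ln_nat_near_ge.
have Lc : 2 / c <= L by rewrite LE NE; near: n; exact: ln_nat_near_ge.
have Nl : 2 * l%:R / c <= N by rewrite NE; near: n; exact: nbhs_infty_ger.
have N0 : 0 < N by rewrite NE ltr0n ltnW.
have NL : N = expR L by rewrite LE lnK ?posrE.
have L2N : 4 * L ^+ 2 <= N by rewrite NL sqr_le_expR.
have L0 : 0 < L by lra.
have aL : `|alpha n| <= 8^-1 * L.
  have : `| `|alpha n| | <= 8^-1 * `|ln n%:R : R| by near: n; exact: alphaL.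
  by rewrite normr_id -NE -LE [X in _ <= _ * X]gtr0_norm.
have PcL : c * (N * L ^+ 5) <= (P n)%:R.
  have : c * `|n%:R * ln n%:R ^+ 5 : R| <= `|(P n)%:R : R| by near: n; exact: Pc.
  by rewrite -NE -LE gtr0_norm ?mulr_gt0 ?exprn_gt0// ger0_norm.
have NbE : N * b = L + l%:R * ln L + alpha n.
  by rewrite bE halpha// -NE -LE mulrC divfK// gt_eqF.
have /andP[lL0 lL8] := mulr_ln_le Ll.
have := aL; rewrite ler_norml => /andP[a1 a2].
(* Both [l ln L] and [|alpha|] are at most [L / 8]. *)
have b_ge : 3 / 4 * L <= N * b by rewrite NbE; lra.
have b_le : N * b <= 5 / 4 * L by rewrite NbE; lra.
have /andP[p0 p1] := hp n.
split; first by split => //; lra.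
split => //.
  (* The fifth power of the logarithm enters here: [N p L > 1] would give
     [P <= (N p L)^2 P = N (N b) L^2], of order [N L^3], against [P >= c N L^5]. *)
  rewrite leNgt; apply/negP => npL.
  have sq : 1 <= (N * p n * L) ^+ 2 by rewrite exprn_ege1// ltW.
  have h1 : c * (N * L ^+ 5) <= N * (5 / 4 * L) * L ^+ 2.
    apply: (le_trans PcL); apply: (@le_trans _ _ ((N * p n * L) ^+ 2 * (P n)%:R)).
      by rewrite ler_peMl.
    rewrite (_ : _ * _ = N * (N * b) * L ^+ 2); last by rewrite bE; ring.
    by rewrite ler_wpM2r ?sqr_ge0// ler_wpM2l// ltW.
  have : c * L ^+ 2 <= 5 / 4.
    have NL3 : 0 < N * L ^+ 3 by rewrite mulr_gt0 ?exprn_gt0.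
    by rewrite -(ler_pM2r NL3); move: h1; rewrite !exprS !expr0; lra.
  apply/negP; rewrite -ltNge.
  have cL : 2 <= c * L by rewrite mulrC -ler_pdivrMr.
  by apply: (@lt_le_trans _ _ 2); [lra|rewrite expr2 mulrA; apply: (le_trans cL); rewrite ler_peMr; lra].
rewrite -(ler_nat R) natrM; apply: le_trans PcL.
have cN : 2 * l%:R <= c * N by rewrite [leRHS]mulrC -ler_pdivrMr.
apply: (le_trans cN); rewrite mulrA ler_peMr ?mulr_ge0 ?ltW// exprn_egt1 //.
all: lra.
Unshelve. all: by end_near. Qed.

Lemma Gb_prob_k_robust_cvg0 : alpha n @[n --> \oo] --> -oo ->
  Gb_prob (P n) (p n) (fun adj : rel 'I_n => k_robust adj l.+1) @[n --> \oo] --> (0 : R).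
Proof.
move=> /cvgrNyPle alphaNy; apply/cvgrPdistC_le => eps eps0.
pose D : R := 16 ^+ l * l`!%:R.
have D0 : 0 < D by rewrite mulr_gt0 ?exprn_gt0// ltr0n fact_gt0.
(* Chosen so that [exp u - 1 <= eps / 2] exactly when [u <= eta]. *)
pose eta := ln (1 + eps / 2).
have eta0 : 0 < eta by rewrite ln_gt0//; lra.
pose K : R := 5 + 8 * l%:R + 16 * l%:R ^+ 2.
have K0 : 0 < K by rewrite /K ltr_pwDl// ?sqr_ge0 ?mulr_ge0 ?sqr_ge0 ?addr_gt0// ltr_pwDl.
near=> n.
rewrite subr0 ger0_norm; last exact: Gb_event_prob_ge0.
have [[n2 L8 L2N] [bE b_ge b_le npL lP]] : in_window l (P n) (p n) (alpha n) n.
  by near: n; exact: in_window_near.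
apply: le_trans (Gb_prob_k_robust_le erefl erefl erefl n2 (hp n) L8 bE b_ge b_le npL lP) _.
rewrite [leRHS]splitr; apply: lerD.
  have : alpha n <= ln (eps / 2 / D) - 1 by near: n; exact: alphaNy.
  rewrite lerBrDr -ler_expR lnK ?posrE ?divr_gt0// => h.
  by rewrite -/D mulrC -ler_pdivlMr.
rewrite lerBlDl -[leRHS](@lnK R) ?posrE; last by lra.
rewrite ler_expR -/eta.
have LK : K / eta <= ln (n%:R : R) by near: n; exact: ln_nat_near_ge.
move: LK; rewrite ler_pdivrMr// => LK.
have N0 : 0 < n%:R :> R by rewrite ltr0n ltnW.
rewrite ler_pdivrMr//; move: LK L2N L8; set L := ln _ => LK L2N L8.
have l0 : 0 <= l%:R :> R by [].
have l20 : 0 <= l%:R ^+ 2 :> R by rewrite sqr_ge0.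
(* The numerator is at most [K L] as [L >= 1]; then [K <= L eta] and [L^2 <= N] bound it by
   [eta N]. *)
apply: (@le_trans _ _ (K * L)); first by rewrite /K; nra.
apply: (@le_trans _ _ (L * eta * L)); first by rewrite ler_wpM2r//; lra.
rewrite mulrAC -expr2 mulrC ler_wpM2l ?(ltW eta0)//.
by apply: le_trans L2N; have := sqr_ge0 L; lra.
Unshelve. all: by end_near. Qed.

Lemma Gb_prob_k_robust_cvg1 : alpha n @[n --> \oo] --> +oo ->
  Gb_prob (P n) (p n) (fun adj : rel 'I_n => k_robust adj l.+1) @[n --> \oo] --> (1 : R).
Proof.
move=> /cvgryPge alphay; apply/cvgrPdist_le => eps eps0.
near=> n.
rewrite ger0_norm; last by rewrite Gb_probC Gb_event_prob_ge0.
have [[n2 L8 L2N] [bE _ b_le npL _]] : in_window l (P n) (p n) (alpha n) n.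
  by near: n; exact: in_window_near.
have expR_le e : 0 < e -> 5 - ln e <= alpha n -> expR (5 - alpha n) <= e.
  by move=> e0 h; rewrite -[leRHS](@lnK R) ?posrE// ler_expR; lra.
have y1 : expR (5 - alpha n) <= 1 / 2.
  by apply: expR_le; [lra|near: n; exact: alphay].
have y2 : expR (5 - alpha n) <= eps / 2.
  by apply: expR_le; [lra|near: n; exact: alphay].
have := Gb_prob_k_robust_ge erefl erefl erefl n2 (hp n) L8 L2N bE b_le npL y1.
lra.
Unshelve. all: by end_near. Qed.

End CriticalWindow.

Theorem theorem5 (R : realType) (k : nat) (P : nat -> nat)
    (p alpha : nat -> R)
    (hk : (0 < k)%N)
    (hp : forall n, 0 <= p n <= 1)
    (halpha : forall n, (2 <= n)%N ->
       p n ^+ 2 * (P n)%:R =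
       (ln n%:R + (k%:R - 1) * ln (ln n%:R) + alpha n) / n%:R)
    (hP : (fun n : nat => (P n)%:R : R) \is
       'Omega_\oo (fun n : nat => n%:R * ln n%:R ^+ 5 : R))
    (halpha_o : (fun n : nat => `|alpha n|) =o_\oo (fun n : nat => ln n%:R : R)) :
  (alpha n @[n --> \oo] --> -oo ->
     Gb_prob (P n) (p n) (fun adj : rel 'I_n => k_robust adj k)
       @[n --> \oo] --> (0 : R)) /\
  (alpha n @[n --> \oo] --> +oo ->
     Gb_prob (P n) (p n) (fun adj : rel 'I_n => k_robust adj k)
       @[n --> \oo] --> (1 : R)).
Proof.
(* Writing [k = l + 1] turns the real number [k - 1] into the natural number [l]. *)
case: k hk halpha => // l _ halpha.
have halpha_l n : (2 <= n)%N -> p n ^+ 2 * (P n)%:R =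
    (ln n%:R + l%:R * ln (ln n%:R) + alpha n) / n%:R.
  by move=> n2; rewrite halpha// -natr1 addrK.
split; [exact: Gb_prob_k_robust_cvg0 hp halpha_l hP halpha_o|
        exact: Gb_prob_k_robust_cvg1 hp halpha_l hP halpha_o].
Qed.
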